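(* Let $S,T$ be as in the context. Every $\Sigma_1$ provability predicate $\mathrm{Pr}_T(x)$ of $T$ satisfying $\mathbf{E}^{\mathrm{U}}$, $\mathbf{CB}_{\exists}$ and $\mathbf{C}$ also satisfies $\mathbf{D2}$ and $\mathbf{D3}$.
   Context: $\mathcal{L}_A=\{0,\mathsf{s},+,\times,\leq\}$ is the language of first-order arithmetic, and ''formula'' means $\mathcal{L}_A$-formula; $\ulcorner\varphi\urcorner$ is the numeral of the Gödel number of $\varphi$. $\Sigma_1$ formulas are those of the form $\exists\vec{x}\,\delta$ with $\delta$ a $\Delta_0$ formula. $S$ and $T$ are consistent c.e. extensions of Peano Arithmetic $\mathsf{PA}$ in the language $\mathcal{L}_A$ such that $T$ is stronger than $S$ (every theorem of $S$ is a theorem of $T$; $S=T$ is allowed). A formula $\mathrm{Pr}_T(x)$ is a provability predicate of $T$ if for every formula $\varphi$: $T\vdash\varphi$ if and only if $S\vdash\mathrm{Pr}_T(\ulcorner\varphi\urcorner)$. A $\Sigma_1$ provability predicate is one that is a $\Sigma_1$ formula. $\ulcorner\varphi(\vec{\dot{x}})\urcorner$ is a term with free variables $\vec{x}$ for the primitive recursive function that computes from $\vec{n}$ the Gödel number of $\varphi(\overline{\vec{n}})$, the result of substituting the numerals of $\vec{n}$ for $\vec{x}$ in $\varphi(\vec{x})$. Conditions on $\mathrm{Pr}_T(x)$: - $\mathbf{E}^{\mathrm{U}}$: for all formulas $\varphi(\vec{x}),\psi(\vec{x})$, if $T\vdash\forall\vec{x}\,(\varphi(\vec{x})\leftrightarrow\psi(\vec{x}))$,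 then $S\vdash\forall\vec{x}\,(\mathrm{Pr}_T(\ulcorner\varphi(\vec{\dot{x}})\urcorner)\leftrightarrow\mathrm{Pr}_T(\ulcorner\psi(\vec{\dot{x}})\urcorner))$. - $\mathbf{CB}_{\exists}$: $S\vdash\exists\vec{x}\,\mathrm{Pr}_T(\ulcorner\varphi(\vec{\dot{x}})\urcorner)\to\mathrm{Pr}_T(\ulcorner\exists\vec{x}\,\varphi(\vec{x})\urcorner)$ for every formula $\varphi(\vec{x})$. - $\mathbf{C}$: $S\vdash\mathrm{Pr}_T(\ulcorner\varphi\urcorner)\land\mathrm{Pr}_T(\ulcorner\psi\urcorner)\to\mathrm{Pr}_T(\ulcorner\varphi\land\psi\urcorner)$ for all formulas $\varphi,\psi$. - $\mathbf{D2}$: $S\vdash\mathrm{Pr}_T(\ulcorner\varphi\to\psi\urcorner)\to(\mathrm{Pr}_T(\ulcorner\varphi\urcorner)\to\mathrm{Pr}_T(\ulcorner\psi\urcorner))$ for all formulas $\varphi,\psi$. - $\mathbf{D3}$: $S\vdash\mathrm{Pr}_T(\ulcorner\varphi\urcorner)\to\mathrm{Pr}_T(\ulcorner\mathrm{Pr}_T(\ulcorner\varphi\urcorner)\urcorner)$ for every formula $\varphi$. *)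

(* Defs.v *)
From Stdlib Require Import Arith List Lia.

(** * Syntax of first-order arithmetic

    Variables are de Bruijn indices.  In a formula phi(x_0,...,x_{n-1}), possibly
    with further parameters, the displayed variables are the indices
    0, ..., n-1 and the parameters are the indices >= n; [exn n phi] and
    [alln n phi] bind exactly the displayed variables. *)

Inductive term : Type :=
| Var (i : nat)
| Zero
| Succ (t : term)
| Add (t u : term)
| Mul (t u : term).

Inductive form : Type :=
| Bot
| Eq (t u : term)
| Le (t u : term)
| Imp (p q : form)
| And (p q : form)
| Or (p q : form)
| All (p : form)
| Ex (p : form).

Definition Neg (p : form) : form := Imp p Bot.
Definition Iff (p q : form) : form := And (Imp p q) (Imp q p).

Definition alln (n : nat) (p : form) : form := Nat.iter n All p.
Definition exn (n : nat) (p : form) : form := Nat.iter n Ex p.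

Definition num (n : nat) : term := Nat.iter n Succ Zero.

Fixpoint tsubst (s : nat -> term) (t : term) : term :=
  match t with
  | Var i => s i
  | Zero => Zero
  | Succ t => Succ (tsubst s t)
  | Add t u => Add (tsubst s t) (tsubst s u)
  | Mul t u => Mul (tsubst s t) (tsubst s u)
  end.

Definition tshift : term -> term := tsubst (fun i => Var (S i)).

Definition scons (t : term) (s : nat -> term) (i : nat) : term :=
  match i with 0 => t | S j => s j end.

Definition up (s : nat -> term) : nat -> term :=
  scons (Var 0) (fun i => tshift (s i)).

Fixpoint subst (s : nat -> term) (p : form) : form :=
  match p with
  | Bot => Bot
  | Eq t u => Eq (tsubst s t) (tsubst s u)
  | Le t u => Le (tsubst s t) (tsubst s u)
  | Imp p q => Imp (subst s p) (subst s q)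
  | And p q => And (subst s p) (subst s q)
  | Or p q => Or (subst s p) (subst s q)
  | All p => All (subst (up s) p)
  | Ex p => Ex (subst (up s) p)
  end.

Definition shift : form -> form := subst (fun i => Var (S i)).

(** p(t): replace variable 0 by t and lower the other variables. *)
Definition inst (p : form) (t : term) : form := subst (scons t Var) p.

(** All free variables are < n. *)
Fixpoint tbound (n : nat) (t : term) : Prop :=
  match t with
  | Var i => i < n
  | Zero => True
  | Succ t => tbound n t
  | Add t u | Mul t u => tbound n t /\ tbound n u
  end.

Fixpoint fbound (n : nat) (p : form) : Prop :=
  match p with
  | Bot => True
  | Eq t u | Le t u => tbound n t /\ tbound n u
  | Imp p q | And p q | Or p q => fbound n p /\ fbound n q
  | All p | Ex p => fbound (S n) p
  end.

(** ** Arithmetical hierarchy *)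

Inductive Delta0 : form -> Prop :=
| D0_Bot : Delta0 Bot
| D0_Eq t u : Delta0 (Eq t u)
| D0_Le t u : Delta0 (Le t u)
| D0_Imp p q : Delta0 p -> Delta0 q -> Delta0 (Imp p q)
| D0_And p q : Delta0 p -> Delta0 q -> Delta0 (And p q)
| D0_Or p q : Delta0 p -> Delta0 q -> Delta0 (Or p q)
| D0_All t p : Delta0 p -> Delta0 (All (Imp (Le (Var 0) (tshift t)) p))
| D0_Ex t p : Delta0 p -> Delta0 (Ex (And (Le (Var 0) (tshift t)) p)).

Definition Sigma1 (p : form) : Prop :=
  exists (n : nat) (d : form), Delta0 d /\ p = exn n d.

(** * Classical first-order logic with equality

    Natural deduction with local hypotheses G over a set T of axioms.  The
    axioms are not shifted under quantifiers: the calculus is used only for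
    sets of sentences. *)

Inductive prv (T : form -> Prop) : list form -> form -> Prop :=
| P_Ax G p : T p -> prv T G p
| P_Hyp G p : In p G -> prv T G p
| P_ImpI G p q : prv T (p :: G) q -> prv T G (Imp p q)
| P_ImpE G p q : prv T G (Imp p q) -> prv T G p -> prv T G q
| P_AndI G p q : prv T G p -> prv T G q -> prv T G (And p q)
| P_AndE1 G p q : prv T G (And p q) -> prv T G p
| P_AndE2 G p q : prv T G (And p q) -> prv T G q
| P_OrI1 G p q : prv T G p -> prv T G (Or p q)
| P_OrI2 G p q : prv T G q -> prv T G (Or p q)
| P_OrE G p q r :
    prv T G (Or p q) -> prv T (p :: G) r -> prv T (q :: G) r -> prv T G r
| P_AllI G p : prv T (map shift G) p -> prv T G (All p)
| P_AllE G p t : prv T G (All p) -> prv T G (inst p t)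
| P_ExI G p t : prv T G (inst p t) -> prv T G (Ex p)
| P_ExE G p q :
    prv T G (Ex p) -> prv T (p :: map shift G) (shift q) -> prv T G q
| P_Raa G p : prv T (Neg p :: G) Bot -> prv T G p
| P_EqI G t : prv T G (Eq t t)
| P_EqE G t u p : prv T G (Eq t u) -> prv T G (inst p t) -> prv T G (inst p u).

Definition proves (T : form -> Prop) (p : form) : Prop := prv T nil p.

Notation "T |-- p" := (proves T p) (at level 70, no associativity).

Definition consistent (T : form -> Prop) : Prop := ~ (T |-- Bot).

Definition sentences (T : form -> Prop) : Prop := forall p, T p -> fbound 0 p.

Definition stronger (T S : form -> Prop) : Prop :=
  forall p, S |-- p -> T |-- p.

(** * Peano Arithmetic *)

Definition induction (p : form) : form :=
  Imp (inst p Zero)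
   (Imp (All (Imp p (subst (scons (Succ (Var 0)) (fun i => Var (S i))) p)))
     (All p)).

Inductive PA : form -> Prop :=
| PA_succ0 : PA (All (Neg (Eq (Succ (Var 0)) Zero)))
| PA_succ_inj :
    PA (All (All (Imp (Eq (Succ (Var 1)) (Succ (Var 0))) (Eq (Var 1) (Var 0)))))
| PA_add0 : PA (All (Eq (Add (Var 0) Zero) (Var 0)))
| PA_addS :
    PA (All (All (Eq (Add (Var 1) (Succ (Var 0))) (Succ (Add (Var 1) (Var 0))))))
| PA_mul0 : PA (All (Eq (Mul (Var 0) Zero) Zero))
| PA_mulS :
    PA (All (All (Eq (Mul (Var 1) (Succ (Var 0)))
                     (Add (Mul (Var 1) (Var 0)) (Var 1)))))
| PA_le :
    PA (All (All (Iff (Le (Var 1) (Var 0))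
                      (Ex (Eq (Add (Var 0) (Var 2)) (Var 1))))))
| PA_induct n p : fbound (S n) p -> PA (alln n (induction p)).

(** * Goedel numbering

    [pair] is an injective pairing function that is the value of an
    arithmetical term.  Formulas and terms are coded by tagged pairing, except
    that a block of successors is coded by its length: a term s^k(u), with u
    not a successor, is coded by the pair of k and the code of u.  With this
    numbering, the function sending n_0,...,n_{m-1} to the code of the formula
    phi(n_0,...,n_{m-1}) (with numerals substituted) is, for each fixed phi, a
    polynomial, hence denoted by a term [gdot] of the language; see
    [gform_inj], [gdot_spec] and [gdot_bound]. *)

Definition pair (a b : nat) : nat := (a + b) * (a + b) + a.

(** [gterm k t] is the code of s^k(t). *)
Fixpoint gterm (k : nat) (t : term) : nat :=
  match t with
  | Succ u => gterm (S k) u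
  | Zero => pair k (pair 0 0)
  | Var i => pair k (pair 1 i)
  | Add t u => pair k (pair 2 (pair (gterm 0 t) (gterm 0 u)))
  | Mul t u => pair k (pair 3 (pair (gterm 0 t) (gterm 0 u)))
  end.

Fixpoint gform (p : form) : nat :=
  match p with
  | Bot => pair 0 0
  | Eq t u => pair 1 (pair (gterm 0 t) (gterm 0 u))
  | Le t u => pair 2 (pair (gterm 0 t) (gterm 0 u))
  | Imp p q => pair 3 (pair (gform p) (gform q))
  | And p q => pair 4 (pair (gform p) (gform q))
  | Or p q => pair 5 (pair (gform p) (gform q))
  | All p => pair 6 (gform p)
  | Ex p => pair 7 (gform p)
  end.

Definition quote (p : form) : term := num (gform p).

Definition tpair (a b : term) : term := Add (Mul (Add a b) (Add a b)) a.

(** [gdot n p] is the term written with dotted variables x_0,...,x_{n-1}.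
    Below l binders, the indices < l are bound, the next n indices are the
    dotted variables, which are replaced by numerals, and the remaining
    parameters of p stay (lowered) variables of the quoted formula. *)
Fixpoint gdot_term (n l k : nat) (t : term) : term :=
  match t with
  | Succ u => gdot_term n l (S k) u
  | Zero => tpair (num k) (num (pair 0 0))
  | Var i =>
      if i <? l then tpair (num k) (num (pair 1 i))
      else if i <? l + n
      then tpair (Nat.iter k Succ (Var (i - l))) (num (pair 0 0))
      else tpair (num k) (num (pair 1 (i - n)))
  | Add t u =>
      tpair (num k)
        (tpair (num 2) (tpair (gdot_term n l 0 t) (gdot_term n l 0 u)))
  | Mul t u =>
      tpair (num k)
        (tpair (num 3) (tpair (gdot_term n l 0 t) (gdot_term n l 0 u)))
  end.

Fixpoint gdot_form (n l : nat) (p : form) : term :=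
  match p with
  | Bot => tpair (num 0) (num 0)
  | Eq t u =>
      tpair (num 1) (tpair (gdot_term n l 0 t) (gdot_term n l 0 u))
  | Le t u =>
      tpair (num 2) (tpair (gdot_term n l 0 t) (gdot_term n l 0 u))
  | Imp p q => tpair (num 3) (tpair (gdot_form n l p) (gdot_form n l q))
  | And p q => tpair (num 4) (tpair (gdot_form n l p) (gdot_form n l q))
  | Or p q => tpair (num 5) (tpair (gdot_form n l p) (gdot_form n l q))
  | All p => tpair (num 6) (gdot_form n (S l) p)
  | Ex p => tpair (num 7) (gdot_form n (S l) p)
  end.

Definition gdot (n : nat) (p : form) : term := gdot_form n 0 p.

Lemma pair_inj a b c d : pair a b = pair c d -> a = c /\ b = d.
Proof.
unfold pair; intros H.
assert (a + b = c + d) by nia.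
assert (a = c) by nia.
lia.
Qed.

Lemma iter_Succ_comm k t : Nat.iter k Succ (Succ t) = Nat.iter (S k) Succ t.
Proof. induction k as [|k IH]; simpl in *; congruence. Qed.

Ltac pair_inv :=
  repeat match goal with
  | H : pair _ _ = pair _ _ |- _ => apply pair_inj in H; destruct H
  end; try discriminate.

Lemma gterm_inj t u k m :
  gterm k t = gterm m u -> Nat.iter k Succ t = Nat.iter m Succ u.
Proof.
revert u k m; induction t as [i| |t IH|t1 IH1 t2 IH2|t1 IH1 t2 IH2];
  intros u k m H; cbn [gterm] in H.
3: rewrite iter_Succ_comm; apply IH; exact H.
all: revert m H; induction u as [j| |u IHu|u1 _ u2 _|u1 _ u2 _];
  intros m H; cbn [gterm] in H;
  try (rewrite iter_Succ_comm; apply IHu; exact H); pair_inv; subst;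
  try reflexivity.
all: apply IH1 in H1; apply IH2 in H2; simpl in H1, H2; now subst.
Qed.

Lemma gform_inj p q : gform p = gform q -> p = q.
Proof.
revert q; induction p; intros [] H; cbn [gform] in H; pair_inv;
repeat match goal with
  | H : gterm 0 _ = gterm 0 _ |- _ => apply gterm_inj in H; simpl in H
  end; f_equal; auto.
Qed.

Fixpoint teval (v : nat -> nat) (t : term) : nat :=
  match t with
  | Var i => v i
  | Zero => 0
  | Succ t => S (teval v t)
  | Add t u => teval v t + teval v u
  | Mul t u => teval v t * teval v u
  end.

(** Substitution of the numerals of v 0, ..., v (n-1) for the first n
    variables. *)
Definition num_subst (n : nat) (v : nat -> nat) (i : nat) : term :=
  if i <? n then num (v i) else Var (i - n).

Lemma teval_iter_Succ v k t : teval v (Nat.iter k Succ t) = k + teval v t.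
Proof. induction k as [|k IH]; simpl; congruence. Qed.

Lemma teval_num v k : teval v (num k) = k.
Proof. unfold num; rewrite teval_iter_Succ; simpl; lia. Qed.

Lemma tshift_num k : tshift (num k) = num k.
Proof.
induction k as [|k IH]; [reflexivity|].
change (Succ (tshift (num k)) = Succ (num k)); now rewrite IH.
Qed.

Lemma gterm_num k m : gterm k (num m) = pair (k + m) (pair 0 0).
Proof.
revert k; induction m as [|m IH]; intros k; cbn [num Nat.iter nat_rect gterm].
- now rewrite Nat.add_0_r.
- change (gterm (S k) (num m) = pair (k + S m) (pair 0 0)).
  rewrite IH; f_equal; lia.
Qed.

Lemma iter_up_num_subst n v l i :
  Nat.iter l up (num_subst n v) i =
  if i <? l then Var i
  else if i <? l + n then num (v (i - l)) else Var (i - n).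
Proof.
revert i; induction l as [|l IH]; intros i.
- simpl; unfold num_subst; now rewrite Nat.sub_0_r.
- destruct i as [|i]; [reflexivity|].
  change (tshift (Nat.iter l up (num_subst n v) i) =
          if i <? l then Var (S i)
          else if i <? l + n then num (v (i - l)) else Var (S i - n)).
  rewrite IH; destruct (Nat.ltb_spec i l); [reflexivity|].
  destruct (Nat.ltb_spec i (l + n)); [apply tshift_num|].
  change (Var (S (i - n)) = Var (S i - n)); apply f_equal; lia.
Qed.

Lemma teval_tpair v a b : teval v (tpair a b) = pair (teval v a) (teval v b).
Proof. reflexivity. Qed.

Lemma gdot_term_spec n v l k t :
  teval v (gdot_term n l k t) =
  gterm k (tsubst (Nat.iter l up (num_subst n v)) t).
Proof.
revert k; induction t as [i| |t IH|t IHt u IHu|t IHt u IHu]; intros k;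
  cbn [gdot_term tsubst gterm].
- rewrite iter_up_num_subst.
  destruct (i <? l); [|destruct (i <? l + n)];
    rewrite teval_tpair, ?teval_iter_Succ, !teval_num, ?gterm_num; reflexivity.
- now rewrite teval_tpair, !teval_num.
- apply IH.
- now rewrite !teval_tpair, !teval_num, IHt, IHu.
- now rewrite !teval_tpair, !teval_num, IHt, IHu.
Qed.

Lemma gdot_form_spec n v l p :
  teval v (gdot_form n l p) =
  gform (subst (Nat.iter l up (num_subst n v)) p).
Proof.
revert l; induction p; intros l; cbn [gdot_form subst gform];
  rewrite ?teval_tpair, ?teval_num, ?gdot_term_spec, ?IHp1, ?IHp2, ?IHp;
  reflexivity.
Qed.

Lemma gdot_spec n v p :
  teval v (gdot n p) = gform (subst (num_subst n v) p).
Proof. apply gdot_form_spec. Qed.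

Lemma tbound_iter_Succ n k t : tbound n t -> tbound n (Nat.iter k Succ t).
Proof. induction k; simpl; auto. Qed.

Lemma tbound_num n k : tbound n (num k).
Proof. now apply tbound_iter_Succ. Qed.

Lemma tbound_tpair n a b : tbound n a -> tbound n b -> tbound n (tpair a b).
Proof. simpl; auto. Qed.

Lemma gdot_term_bound n l k t : tbound n (gdot_term n l k t).
Proof.
revert k; induction t as [i| | | |]; intros k; cbn [gdot_term];
  try solve [auto using tbound_tpair, tbound_num].
destruct (Nat.ltb_spec i l); [auto using tbound_tpair, tbound_num|].
destruct (Nat.ltb_spec i (l + n)); [|auto using tbound_tpair, tbound_num].
apply tbound_tpair; [apply tbound_iter_Succ; simpl; lia|apply tbound_num].
Qed.

Lemma gdot_bound n p : tbound n (gdot n p).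
Proof.
unfold gdot; generalize 0 as l.
induction p; intros l; cbn [gdot_form];
  auto using tbound_tpair, tbound_num, gdot_term_bound.
Qed.

(** * Computable enumerability

    Partial recursive functions on tuples; an expression applied to a tuple of
    the wrong length is undefined or ignores the superfluous entries. *)

Inductive recf : Type :=
| RZero
| RSucc
| RProj (i : nat)
| RComp (f : recf) (gs : list recf)
| RPrec (f g : recf)
| RMu (f : recf).

Inductive reval : recf -> list nat -> nat -> Prop :=
| RE_Zero v : reval RZero v 0
| RE_Succ x v : reval RSucc (x :: v) (S x)
| RE_Proj i v x : nth_error v i = Some x -> reval (RProj i) v x
| RE_Comp f gs v ws y : revals gs v ws -> reval f ws y -> reval (RComp f gs) v y
| RE_Prec0 f g v y : reval f v y -> reval (RPrec f g) (0 :: v) y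
| RE_PrecS f g n v z y :
    reval (RPrec f g) (n :: v) z -> reval g (n :: z :: v) y ->
    reval (RPrec f g) (S n :: v) y
| RE_Mu f v n :
    reval f (n :: v) 0 ->
    (forall m, m < n -> exists k, reval f (m :: v) (S k)) ->
    reval (RMu f) v n
with revals : list recf -> list nat -> list nat -> Prop :=
| RE_nil v : revals nil v nil
| RE_cons g gs v y ys :
    reval g v y -> revals gs v ys -> revals (g :: gs) v (y :: ys).

Definition ce_set (P : nat -> Prop) : Prop :=
  exists f : recf, forall n, P n <-> exists y, reval f (n :: nil) y.

Definition ce (T : form -> Prop) : Prop :=
  ce_set (fun n => exists p, T p /\ n = gform p).

(** A theory is given by its set of axioms. *)
Definition ce_extension_of_PA (T : form -> Prop) : Prop :=
  sentences T /\ ce T /\ stronger T PA.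

(** * Provability predicates *)

Definition provability_predicate (S T : form -> Prop) (Pr : form) : Prop :=
  fbound 1 Pr /\ forall p, T |-- p <-> S |-- inst Pr (quote p).

Definition cond_EU (S T : form -> Prop) (Pr : form) : Prop :=
  forall (n : nat) (p q : form),
    T |-- alln n (Iff p q) ->
    S |-- alln n (Iff (inst Pr (gdot n p)) (inst Pr (gdot n q))).

Definition cond_CBex (S : form -> Prop) (Pr : form) : Prop :=
  forall (n : nat) (p : form),
    S |-- Imp (exn n (inst Pr (gdot n p))) (inst Pr (quote (exn n p))).

Definition cond_C (S : form -> Prop) (Pr : form) : Prop :=
  forall p q : form,
    S |-- Imp (And (inst Pr (quote p)) (inst Pr (quote q)))
              (inst Pr (quote (And p q))).

Definition cond_D2 (S : form -> Prop) (Pr : form) : Prop :=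
  forall p q : form,
    S |-- Imp (inst Pr (quote (Imp p q)))
              (Imp (inst Pr (quote p)) (inst Pr (quote q))).

Definition cond_D3 (S : form -> Prop) (Pr : form) : Prop :=
  forall p : form,
    S |-- Imp (inst Pr (quote p))
              (inst Pr (quote (inst Pr (quote p)))).

(* Main.v *)
From Stdlib Require Import Arith List Lia Bool.
Require Import Defs.
Import ListNotations.

(** Monotonicity of [Pr] follows from E^U and CB_ex applied to a formula x(v)
    that is equivalent to p at 0 and to q at 1; with C it gives D2.

    For D3, provable Delta0-completeness is obtained from E^U alone.  For a
    Delta0 formula c with numerals substituted for its variables, S proves that
    Pr("if c then p else q") is equivalent to Pr(p) if c holds, and to Pr(q)
    otherwise.  E^U lets one rewrite the quoted formula by T-provable
    equivalences, so connectives reduce to nested conditionals, and terms,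
    atoms and bounded quantifiers are handled by inductions inside S which
    change the numerals one successor at a time.  Hence S proves
    d -> Pr(d) for d in Delta0, and CB_ex passes to Sigma1. *)

(** * Substitution *)

(** Without D2 nothing can be inferred under the quotation: E^U only exchanges a quoted formula for
    a T-equivalent one, so a fact that S knows about particular values cannot be used there
    directly. Conditionals with arbitrary branches get around this: a branch may itself be a
    conditional, so the claims for two conditions compose although E^U alone does not make [Pr]
    distribute over any connective. The other obstacle is that, for variables x and y of S, the
    numeral of x + y and the sum of the numerals of x and y are different quoted terms, which E^U
    does not relate directly. A successor, however, crosses the quotation by mere syntax, because
    the Goedel numbering codes a block of successors by its length. Inside the quotation, T-provable
    open equations such as x + s(y) = s(x) + y move that successor, and induction in S does the
    rest. *)

Lemma tsubst_ext_bound n s s' t :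
  tbound n t -> (forall i, i < n -> s i = s' i) -> tsubst s t = tsubst s' t.
Proof.
induction t; simpl; intros Ht H; f_equal; intuition auto.
Qed.

Lemma up_ext_bound n s s' :
  (forall i, i < n -> s i = s' i) -> forall i, i < S n -> up s i = up s' i.
Proof.
intros H [|i] Hi; [reflexivity|]; unfold up; simpl; rewrite H; [reflexivity|lia].
Qed.

Lemma subst_ext_bound n s s' p :
  fbound n p -> (forall i, i < n -> s i = s' i) -> subst s p = subst s' p.
Proof.
revert n s s'; induction p; simpl; intros n s s' Hp H; f_equal;
  try (destruct Hp; eauto using tsubst_ext_bound; fail);
  eapply IHp; eauto using up_ext_bound.
Qed.

Lemma tsubst_ext s s' t : (forall i, s i = s' i) -> tsubst s t = tsubst s' t.
Proof. induction t; simpl; intros; f_equal; auto. Qed.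

Lemma up_ext s s' : (forall i, s i = s' i) -> forall i, up s i = up s' i.
Proof. intros H [|i]; [reflexivity|]; unfold up; simpl; now rewrite H. Qed.

Lemma subst_ext s s' p : (forall i, s i = s' i) -> subst s p = subst s' p.
Proof.
revert s s'; induction p; simpl; intros s s' H; f_equal;
  auto using tsubst_ext, up_ext.
Qed.

Lemma tsubst_comp r s t :
  tsubst r (tsubst s t) = tsubst (fun i => tsubst r (s i)) t.
Proof. induction t; simpl; congruence. Qed.

Lemma up_comp r s i :
  tsubst (up r) (up s i) = up (fun j => tsubst r (s j)) i.
Proof.
destruct i as [|i]; [reflexivity|].
unfold up, tshift; simpl; rewrite !tsubst_comp; reflexivity.
Qed.

Lemma subst_comp r s p :
  subst r (subst s p) = subst (fun i => tsubst r (s i)) p.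
Proof.
revert r s; induction p; simpl; intros r s; rewrite ?tsubst_comp; f_equal; auto;
  rewrite IHp; apply subst_ext, up_comp.
Qed.

Lemma tsubst_Var t : tsubst Var t = t.
Proof. induction t; simpl; congruence. Qed.

Lemma up_Var i : up Var i = Var i.
Proof. now destruct i. Qed.

Lemma subst_Var p : subst Var p = p.
Proof.
induction p; simpl; rewrite ?tsubst_Var; f_equal; auto;
  now rewrite (subst_ext _ Var) by apply up_Var.
Qed.

Lemma tsubst_closed s t : tbound 0 t -> tsubst s t = t.
Proof.
intros H; rewrite <- (tsubst_Var t) at 2; eapply tsubst_ext_bound; eauto; lia.
Qed.

Lemma subst_closed s p : fbound 0 p -> subst s p = p.
Proof.
intros H; rewrite <- (subst_Var p) at 2; eapply subst_ext_bound; eauto; lia.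
Qed.

Lemma tsubst_num s k : tsubst s (num k) = num k.
Proof. apply tsubst_closed, tbound_num. Qed.

Lemma subst_inst s p t : subst s (inst p t) = inst (subst (up s) p) (tsubst s t).
Proof.
unfold inst; rewrite !subst_comp; apply subst_ext; intros [|i]; [reflexivity|].
unfold up, tshift; simpl; rewrite tsubst_comp; simpl; now rewrite tsubst_Var.
Qed.

Lemma subst_shift s p : subst s (shift p) = subst (fun i => s (S i)) p.
Proof. unfold shift; now rewrite subst_comp. Qed.

Lemma subst_up_shift s p : subst (up s) (shift p) = shift (subst s p).
Proof. unfold shift; rewrite !subst_comp; now apply subst_ext. Qed.

Lemma inst_shift p t : inst (shift p) t = p.
Proof. unfold inst; rewrite subst_shift; apply subst_Var. Qed.

Lemma subst_scons t s p : subst (scons t s) p = inst (subst (up s) p) t.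
Proof.
unfold inst; rewrite subst_comp; apply subst_ext; intros [|i]; [reflexivity|].
unfold up, tshift; simpl; rewrite tsubst_comp; simpl; now rewrite tsubst_Var.
Qed.

Lemma subst_exn s n p : subst s (exn n p) = exn n (subst (Nat.iter n up s) p).
Proof.
revert s; induction n as [|n IH]; intros s; [reflexivity|].
change (Ex (subst (up s) (exn n p)) =
        Ex (exn n (subst (Nat.iter (S n) up s) p))).
now rewrite IH, <- Nat.iter_succ_r.
Qed.

Lemma tbound_mono n m t : n <= m -> tbound n t -> tbound m t.
Proof. intros H; induction t; simpl; intuition lia. Qed.

Lemma fbound_mono n m p : n <= m -> fbound n p -> fbound m p.
Proof.
revert n m; induction p; simpl; intros n m H Hp;
  intuition eauto using tbound_mono.
all: eapply IHp; [|eassumption]; lia.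
Qed.

Lemma tbound_ex t : exists n, tbound n t.
Proof.
induction t as [i| |t IH|t [a Ha] u [b Hb]|t [a Ha] u [b Hb]]; simpl.
- exists (S i); lia.
- now exists 0.
- assumption.
- exists (max a b); split; (eapply tbound_mono; [|eassumption]); lia.
- exists (max a b); split; (eapply tbound_mono; [|eassumption]); lia.
Qed.

Lemma fbound_ex p : exists n, fbound n p.
Proof.
induction p as [|t u|t u|p [a Ha] q [b Hb]|p [a Ha] q [b Hb]|p [a Ha] q [b Hb]
  |p [a Ha]|p [a Ha]]; simpl.
1: now exists 0.
1,2: destruct (tbound_ex t) as [a Ha], (tbound_ex u) as [b Hb];
  exists (max a b); split; (eapply tbound_mono; [|eassumption]); lia.
1-3: exists (max a b); split; (eapply fbound_mono; [|eassumption]); lia.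
all: exists a; (eapply fbound_mono; [|eassumption]); lia.
Qed.

Lemma tbound_tsubst m n s t :
  tbound n t -> (forall i, i < n -> tbound m (s i)) -> tbound m (tsubst s t).
Proof. induction t; simpl; intuition. Qed.

Lemma up_bound m n s :
  (forall i, i < n -> tbound m (s i)) ->
  forall i, i < S n -> tbound (S m) (up s i).
Proof.
intros H [|i] Hi; simpl; [lia|].
eapply tbound_tsubst; [apply H; lia|simpl; lia].
Qed.

Lemma fbound_subst m n s p :
  fbound n p -> (forall i, i < n -> tbound m (s i)) -> fbound m (subst s p).
Proof.
revert m n s; induction p; simpl; intros m n s Hp Hs;
  intuition eauto using tbound_tsubst;
  eapply IHp; eauto using up_bound.
Qed.

(** * Derived rules *)

Section Calculus.
Context {T : form -> Prop}.

Lemma prv_weaken G G' p : incl G G' -> prv T G p -> prv T G' p.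
Proof.
assert (E : forall q L L', incl L L' -> @incl form (q :: L) (q :: L')).
{ intros q L L' H; apply incl_cons; [apply in_eq|now apply incl_tl]. }
intros HG H; revert G' HG; induction H; intros G' HG.
- now apply P_Ax.
- apply P_Hyp; auto.
- apply P_ImpI; auto.
- apply P_ImpE with p; auto.
- apply P_AndI; auto.
- apply P_AndE1 with q; auto.
- apply P_AndE2 with p; auto.
- apply P_OrI1; auto.
- apply P_OrI2; auto.
- apply P_OrE with p q; auto.
- apply P_AllI, IHprv, incl_map; assumption.
- apply P_AllE; auto.
- apply P_ExI with t; auto.
- apply P_ExE with p; [auto|apply IHprv2, E, incl_map; assumption].
- apply P_Raa; auto.
- apply P_EqI.
- apply P_EqE with t; auto.
Qed.

Lemma prv_nil G p : T |-- p -> prv T G p.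
Proof. apply prv_weaken; intros ? []. Qed.

Lemma prv_weaken1 G q p : prv T G p -> prv T (q :: G) p.
Proof. apply prv_weaken; intros x; simpl; auto. Qed.

Lemma prv_hyp0 G p : prv T (p :: G) p.
Proof. apply P_Hyp; simpl; auto. Qed.

Lemma prv_cut G p q : prv T G p -> prv T (p :: G) q -> prv T G q.
Proof. intros H1 H2; eapply P_ImpE; [apply P_ImpI|]; eassumption. Qed.

Lemma prv_exfalso G p : prv T G Bot -> prv T G p.
Proof. intros H; apply P_Raa, prv_weaken1, H. Qed.

Lemma prv_cases G q p : prv T (q :: G) p -> prv T (Neg q :: G) p -> prv T G p.
Proof.
intros H1 H2; apply P_Raa.
apply P_ImpE with p; [apply prv_hyp0|].
apply prv_cut with (Neg q).
- apply P_ImpI; apply P_ImpE with p; [apply P_Hyp; simpl; auto|].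
  revert H1; apply prv_weaken; intros x [->|Hx]; simpl; auto.
- revert H2; apply prv_weaken; intros x [->|Hx]; simpl; auto.
Qed.

(** Axioms are not shifted under binders, so they have to be closed: only then does a substitution
    leave them in the theory. *)
Lemma prv_subst (HT : sentences T) s G p :
  prv T G p -> prv T (map (subst s) G) (subst s p).
Proof.
assert (E : forall s G,
  map (subst (up s)) (map shift G) = map shift (map (subst s) G)).
{ intros r L; rewrite !map_map; apply map_ext; intros; apply subst_up_shift. }
intros H; revert s; induction H; intros s; simpl in *;
  auto using P_ImpI, P_AndI, P_OrI1, P_OrI2, P_EqI.
- rewrite subst_closed by auto; now apply P_Ax.
- apply P_Hyp, in_map; assumption.
- apply P_ImpE with (subst s p); auto.
- apply P_AndE1 with (subst s q); auto.
- apply P_AndE2 with (subst s p); auto.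
- apply P_OrE with (subst s p) (subst s q); auto.
- apply P_AllI; rewrite <- E; apply IHprv.
- rewrite subst_inst; apply P_AllE, IHprv.
- apply P_ExI with (tsubst s t); rewrite <- subst_inst; apply IHprv.
- apply P_ExE with (subst (up s) p); [apply IHprv1|].
  rewrite <- E, <- subst_up_shift; apply IHprv2.
- apply P_Raa, IHprv.
- rewrite subst_inst; apply P_EqE with (tsubst s t); [apply IHprv1|].
  rewrite <- subst_inst; apply IHprv2.
Qed.

Lemma proves_subst (HT : sentences T) s G p : T |-- p -> prv T G (subst s p).
Proof. intros H; apply prv_nil, (prv_subst HT s _ _ H). Qed.

Lemma alln_I n p : T |-- p -> T |-- alln n p.
Proof. intros H; induction n; [exact H|apply P_AllI; assumption]. Qed.

Lemma alln_E (HT : sentences T) n p : T |-- alln n p -> T |-- p.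
Proof.
induction n as [|n IH]; intros H; [exact H|].
apply IH; change (T |-- All (alln n p)) in H.
(* The body is its own renaming under the binder, instantiated at [Var 0]. *)
rewrite <- (subst_Var (alln n p)).
rewrite (subst_ext Var (scons (Var 0) (fun i => Var (S i)))) by now intros [].
rewrite subst_scons; apply P_AllE.
exact (prv_subst HT (fun i => Var (S i)) _ _ H).
Qed.

Lemma exn_mono n p q : T |-- Imp p q -> T |-- Imp (exn n p) (exn n q).
Proof.
intros H; induction n as [|n IH]; [exact H|].
change (T |-- Imp (Ex (exn n p)) (Ex (exn n q))).
apply P_ImpI; eapply P_ExE; [apply prv_hyp0|].
change (shift (Ex (exn n q)))
  with (Ex (subst (up (fun i => Var (S i))) (exn n q))).
apply P_ExI with (Var 0); rewrite <- subst_scons.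
rewrite (subst_ext _ Var) by now intros [].
rewrite subst_Var; eapply P_ImpE; [apply prv_nil, IH|apply prv_hyp0].
Qed.

(** * Propositional reasoning by truth tables *)

Fixpoint pval (v : form -> bool) (p : form) : bool :=
  match p with
  | Bot => false
  | Imp p q => implb (pval v p) (pval v q)
  | And p q => pval v p && pval v q
  | Or p q => pval v p || pval v q
  | a => v a
  end.

Fixpoint all_true (v : form -> bool) (G : list form) : Prop :=
  match G with
  | [] => True
  | p :: G => pval v p = true /\ all_true v G
  end.

Lemma form_eq_dec (p q : form) : {p = q} + {p <> q}.
Proof. repeat decide equality. Qed.

Fixpoint atoms (p : form) : list form :=
  match p with
  | Bot => []
  | Imp p q | And p q | Or p q => atoms p ++ atoms q
  | a => [a]
  end.

Definition literals (v : form -> bool) : list form -> list form :=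
  map (fun a => if v a then a else Neg a).

(** Kalmar's lemma, by induction on [p]; equations, inequalities and quantified formulas count as
    atoms. *)
Lemma prv_literals v L G p :
  incl (atoms p) L ->
  prv T (literals v L ++ G) (if pval v p then p else Neg p).
Proof.
assert (Hat : forall a, In a L ->
  prv T (literals v L ++ G) (if v a then a else Neg a)).
{ intros a Ha; apply P_Hyp, in_or_app; left.
  apply in_map with (f := fun a => if v a then a else Neg a); exact Ha. }
induction p; simpl; intros HL; try (apply Hat, HL; simpl; auto; fail).
- apply P_ImpI, prv_hyp0.
- apply incl_app_inv in HL; destruct HL as [H1 H2].
  specialize (IHp1 H1); specialize (IHp2 H2).
  destruct (pval v p1), (pval v p2); simpl; apply P_ImpI.
  + now apply prv_weaken1.
  + apply P_ImpE with p2; [now apply prv_weaken1|].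
    apply P_ImpE with p1; [apply prv_hyp0|now apply prv_weaken1].
  + now apply prv_weaken1.
  + apply prv_exfalso, P_ImpE with p1; [now apply prv_weaken1|apply prv_hyp0].
- apply incl_app_inv in HL; destruct HL as [H1 H2].
  specialize (IHp1 H1); specialize (IHp2 H2).
  destruct (pval v p1), (pval v p2); simpl; try apply P_ImpI.
  + now apply P_AndI.
  + apply P_ImpE with p2;
      [now apply prv_weaken1|eapply P_AndE2, prv_hyp0].
  + apply P_ImpE with p1;
      [now apply prv_weaken1|eapply P_AndE1, prv_hyp0].
  + apply P_ImpE with p1;
      [now apply prv_weaken1|eapply P_AndE1, prv_hyp0].
- apply incl_app_inv in HL; destruct HL as [H1 H2].
  specialize (IHp1 H1); specialize (IHp2 H2).
  destruct (pval v p1), (pval v p2); simpl.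
  1,2: now apply P_OrI1.
  1: now apply P_OrI2.
  apply P_ImpI, P_OrE with p1 p2;
    [apply prv_hyp0|apply P_ImpE with p1|apply P_ImpE with p2];
    auto using prv_weaken1, prv_hyp0.
Qed.

(** The literals are discharged one at a time by excluded middle; [K] holds the atoms that are kept
    meanwhile. *)
Lemma prv_split_literals L G p :
  (forall v, prv T (literals v L ++ G) p) -> prv T G p.
Proof.
enough (H : forall K, (forall v, prv T (literals v (L ++ K) ++ G) p) ->
  forall v, prv T (literals v K ++ G) p).
{ intros HL; apply (H [] ) with (v := fun _ => true).
  intros v; rewrite app_nil_r; apply HL. }
induction L as [|a L IH]; intros K H; [exact H|].
assert (H' : forall v, prv T (literals v (a :: K) ++ G) p).
{ apply IH; intros v; generalize (H v); apply prv_weaken.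
  unfold literals; intros x Hx; rewrite !in_app_iff in *.
  destruct Hx as [Hx|Hx]; [left|now right].
  revert x Hx; apply incl_map; intros x; simpl; rewrite !in_app_iff; simpl; tauto. }
(* A literal already in [K] is a duplicate. Otherwise the value at [a] can be changed without
   affecting the literals of [K], which gives both cases for excluded middle. *)
intros v; destruct (in_dec form_eq_dec a K) as [Ha|Ha].
- generalize (H' v); apply prv_weaken.
  unfold literals; simpl; intros x [<-|Hx]; [|exact Hx].
  apply in_or_app; left.
  apply in_map with (f := fun a => if v a then a else Neg a); exact Ha.
- set (w := fun (b : bool) q => if form_eq_dec q a then b else v q).
  assert (E : forall b, literals (w b) K = literals v K).
  { intros b; apply map_ext_in; intros q Hq; unfold w.
    destruct (form_eq_dec q a) as [->|]; [contradiction|reflexivity]. }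
  pose proof (H' (w true)) as H1; pose proof (H' (w false)) as H2.
  unfold literals in H1, H2; simpl in H1, H2; fold (literals (w true) K) in H1.
  fold (literals (w false) K) in H2; rewrite E in H1, H2.
  unfold w in H1, H2; destruct (form_eq_dec a a); [|congruence].
  now apply prv_cases with a.
Qed.

(** Under each valuation of the atoms either all of [G] is true, and Kalmar's lemma yields [p], or
    the literals refute some hypothesis and the context is inconsistent. *)
Lemma prv_taut G p :
  (forall v, all_true v G -> pval v p = true) -> prv T G p.
Proof.
intros Hv; apply prv_split_literals with (atoms p ++ flat_map atoms G).
intros v; set (A := atoms p ++ _).
assert (HG : Forall (prv T (literals v A ++ G)) G).
{ apply Forall_forall; intros x Hx; apply P_Hyp, in_or_app; now right. }
assert (Ht : forall K, Forall (prv T (literals v A ++ G)) K ->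
  incl (flat_map atoms K) A -> all_true v K \/ prv T (literals v A ++ G) Bot).
{ induction K as [|q K IH]; intros HK HA; [now left|].
  inversion HK; subst; simpl in HA |- *.
  apply incl_app_inv in HA; destruct HA as [HA1 HA2].
  pose proof (prv_literals v A G q HA1) as Hq.
  destruct (pval v q); [destruct IH; auto|].
  right; apply P_ImpE with q; assumption. }
destruct (Ht G HG) as [Hvt|Hf]; [apply incl_appr, incl_refl| |].
- pose proof (prv_literals v A G p (incl_appl _ (incl_refl _))) as Hp.
  now rewrite Hv in Hp.
- now apply prv_exfalso.
Qed.

End Calculus.

Ltac truth_table :=
  intros v; cbn [all_true pval Neg Iff];
  repeat match goal with
  | |- context [pval v ?x] => generalize (pval v x); intro
  | |- context [v ?x] => generalize (v x); intro
  end;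
  repeat match goal with b : bool |- _ => destruct b end;
  simpl; intuition discriminate.

Tactic Notation "ptaut" := apply prv_taut; truth_table.
Tactic Notation "ptaut" constr(H1) := refine (P_ImpE _ _ _ _ _ H1); ptaut.
Tactic Notation "ptaut" constr(H1) constr(H2) :=
  refine (P_ImpE _ _ _ _ _ H1); ptaut H2.
Tactic Notation "ptaut" constr(H1) constr(H2) constr(H3) :=
  refine (P_ImpE _ _ _ _ _ H1); ptaut H2 H3.
Tactic Notation "ptaut" constr(H1) constr(H2) constr(H3) constr(H4) :=
  refine (P_ImpE _ _ _ _ _ H1); ptaut H2 H3 H4.

(** * Equality and induction *)

Section Arithmetic.
Context {T : form -> Prop} (HT : sentences T) (HPA : stronger T PA).

Lemma iff_refl G p : prv T G (Iff p p).
Proof. ptaut. Qed.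

Lemma iff_trans G p q r :
  prv T G (Iff p q) -> prv T G (Iff q r) -> prv T G (Iff p r).
Proof. intros H1 H2; ptaut H1 H2. Qed.

Lemma iff_sym G p q : prv T G (Iff p q) -> prv T G (Iff q p).
Proof. intros H; ptaut H. Qed.


Lemma prv_eq_subst G t u s p :
  prv T G (Eq t u) -> prv T G (subst (scons t s) p) ->
  prv T G (subst (scons u s) p).
Proof. rewrite !subst_scons; apply P_EqE. Qed.

Lemma prv_eq_sym G t u : prv T G (Eq t u) -> prv T G (Eq u t).
Proof.
intros H; apply (prv_eq_subst G t u (fun _ => t) (Eq (Var 0) (Var 1)) H).
apply P_EqI.
Qed.

Lemma prv_eq_trans G t u w :
  prv T G (Eq t u) -> prv T G (Eq u w) -> prv T G (Eq t w).
Proof.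
intros H1 H2; exact (prv_eq_subst G u w (fun _ => t) (Eq (Var 1) (Var 0)) H2 H1).
Qed.

Lemma prv_eq_iff G t u s p :
  prv T G (Eq t u) ->
  prv T G (Iff (subst (scons t s) p) (subst (scons u s) p)).
Proof.
intros H; apply P_AndI; apply P_ImpI; eapply prv_eq_subst.
1: apply prv_weaken1; exact H.
1: apply prv_hyp0.
1: apply prv_weaken1, prv_eq_sym; exact H.
apply prv_hyp0.
Qed.

Lemma prv_eq_succ G t u : prv T G (Eq t u) -> prv T G (Eq (Succ t) (Succ u)).
Proof.
intros H.
apply (prv_eq_subst G t u (fun _ => t) (Eq (Succ (Var 1)) (Succ (Var 0))) H).
apply P_EqI.
Qed.

Lemma prv_eq_add G t u t' u' :
  prv T G (Eq t t') -> prv T G (Eq u u') -> prv T G (Eq (Add t u) (Add t' u')).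
Proof.
intros H1 H2; apply prv_eq_trans with (Add t' u).
- apply (prv_eq_subst G t t' (scons t (fun _ => u))
    (Eq (Add (Var 1) (Var 2)) (Add (Var 0) (Var 2))) H1), P_EqI.
- apply (prv_eq_subst G u u' (scons t' (fun _ => u))
    (Eq (Add (Var 1) (Var 2)) (Add (Var 1) (Var 0))) H2), P_EqI.
Qed.

Lemma prv_eq_mul G t u t' u' :
  prv T G (Eq t t') -> prv T G (Eq u u') -> prv T G (Eq (Mul t u) (Mul t' u')).
Proof.
intros H1 H2; apply prv_eq_trans with (Mul t' u).
- apply (prv_eq_subst G t t' (scons t (fun _ => u))
    (Eq (Mul (Var 1) (Var 2)) (Mul (Var 0) (Var 2))) H1), P_EqI.
- apply (prv_eq_subst G u u' (scons t' (fun _ => u))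
    (Eq (Mul (Var 1) (Var 2)) (Mul (Var 1) (Var 0))) H2), P_EqI.
Qed.

Lemma prv_PA_alln n s G p : PA (alln n p) -> prv T G (subst s p).
Proof.
intros H; apply (proves_subst HT), (alln_E HT n), HPA, P_Ax, H.
Qed.

Lemma prv_succ_neq0 G t : prv T G (Neg (Eq (Succ t) Zero)).
Proof. exact (prv_PA_alln 1 (fun _ => t) G _ PA_succ0). Qed.

Lemma prv_succ_inj G t u :
  prv T G (Eq (Succ t) (Succ u)) -> prv T G (Eq t u).
Proof.
apply P_ImpE; exact (prv_PA_alln 2 (scons u (fun _ => t)) G _ PA_succ_inj).
Qed.

Lemma prv_add0 G t : prv T G (Eq (Add t Zero) t).
Proof. exact (prv_PA_alln 1 (fun _ => t) G _ PA_add0). Qed.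

Lemma prv_addS G t u : prv T G (Eq (Add t (Succ u)) (Succ (Add t u))).
Proof. exact (prv_PA_alln 2 (scons u (fun _ => t)) G _ PA_addS). Qed.

Lemma prv_mul0 G t : prv T G (Eq (Mul t Zero) Zero).
Proof. exact (prv_PA_alln 1 (fun _ => t) G _ PA_mul0). Qed.

Lemma prv_mulS G t u : prv T G (Eq (Mul t (Succ u)) (Add (Mul t u) t)).
Proof. exact (prv_PA_alln 2 (scons u (fun _ => t)) G _ PA_mulS). Qed.

Lemma prv_le_def G t u :
  prv T G (Iff (Le t u) (Ex (Eq (Add (Var 0) (tshift t)) (tshift u)))).
Proof. exact (prv_PA_alln 2 (scons u (fun _ => t)) G _ PA_le). Qed.

Lemma prv_leI G c t u : prv T G (Eq (Add c t) u) -> prv T G (Le t u).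
Proof.
intros H; apply P_ImpE with (2 := P_ExI T G
  (Eq (Add (Var 0) (tshift t)) (tshift u)) c
  ltac:(unfold inst, tshift; simpl; rewrite !tsubst_comp; simpl;
        rewrite !tsubst_Var; exact H)).
eapply P_AndE2, prv_le_def.
Qed.

Lemma prv_leE G t u q :
  prv T G (Le t u) ->
  prv T (Eq (Add (Var 0) (tshift t)) (tshift u) :: map shift G) (shift q) ->
  prv T G q.
Proof.
intros H1; apply P_ExE, P_ImpE with (2 := H1); eapply P_AndE1, prv_le_def.
Qed.

(** The schema offers closed instances only, but every formula has some bound on its variables: its
    induction axiom is taken with all parameters generalized, and the generalization is then
    undone. *)
Lemma prv_induction G p :
  prv T G (inst p Zero) ->
  prv T (p :: map shift G)
    (subst (scons (Succ (Var 0)) (fun i => Var (S i))) p) ->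
  prv T G (All p).
Proof.
intros H0 HS; destruct (fbound_ex p) as [n Hn].
assert (H : prv T G (induction p)).
{ rewrite <- (subst_Var (induction p)); apply prv_PA_alln with n.
  apply PA_induct, fbound_mono with n; auto. }
eapply P_ImpE; [eapply P_ImpE; [exact H|exact H0]|].
apply P_AllI, P_ImpI, HS.
Qed.

Lemma proves_induction p :
  T |-- inst p Zero ->
  prv T [p] (subst (scons (Succ (Var 0)) (fun i => Var (S i))) p) ->
  T |-- p.
Proof. intros H0 HS; apply (alln_E HT 1), prv_induction; assumption. Qed.

Lemma proves_cases p :
  T |-- inst p Zero ->
  T |-- subst (scons (Succ (Var 0)) (fun i => Var (S i))) p ->
  T |-- p.
Proof. intros H0 HS; apply proves_induction; auto using prv_nil. Qed.

Lemma prv_0add G t : prv T G (Eq (Add Zero t) t).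
Proof.
apply (proves_subst HT (fun _ => t) G (Eq (Add Zero (Var 0)) (Var 0))).
apply proves_induction; [apply prv_add0|]; simpl.
eapply prv_eq_trans; [apply prv_addS|apply prv_eq_succ, prv_hyp0].
Qed.

Lemma prv_Sadd G t u : prv T G (Eq (Add (Succ t) u) (Succ (Add t u))).
Proof.
apply (proves_subst HT (scons u (fun _ => t)) G
  (Eq (Add (Succ (Var 1)) (Var 0)) (Succ (Add (Var 1) (Var 0))))).
apply proves_induction; simpl.
- eapply prv_eq_trans; [apply prv_add0|].
  apply prv_eq_sym, prv_eq_succ, prv_add0.
- eapply prv_eq_trans; [apply prv_addS|apply prv_eq_succ].
  eapply prv_eq_trans; [apply prv_hyp0|apply prv_eq_sym, prv_addS].
Qed.

Lemma prv_add_comm G t u : prv T G (Eq (Add t u) (Add u t)).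
Proof.
apply (proves_subst HT (scons u (fun _ => t)) G
  (Eq (Add (Var 1) (Var 0)) (Add (Var 0) (Var 1)))).
apply proves_induction; simpl.
- eapply prv_eq_trans; [apply prv_add0|apply prv_eq_sym, prv_0add].
- eapply prv_eq_trans; [apply prv_addS|].
  eapply prv_eq_trans; [apply prv_eq_succ, prv_hyp0|apply prv_eq_sym, prv_Sadd].
Qed.

Lemma prv_add_assoc G t u w :
  prv T G (Eq (Add (Add t u) w) (Add t (Add u w))).
Proof.
apply (proves_subst HT (scons w (scons u (fun _ => t))) G
  (Eq (Add (Add (Var 2) (Var 1)) (Var 0)) (Add (Var 2) (Add (Var 1) (Var 0))))).
apply proves_induction; simpl.
- eapply prv_eq_trans; [apply prv_add0|apply prv_eq_sym].
  apply prv_eq_add; [apply P_EqI|apply prv_add0].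
- eapply prv_eq_trans; [apply prv_addS|].
  eapply prv_eq_trans; [apply prv_eq_succ, prv_hyp0|].
  eapply prv_eq_trans; [apply prv_eq_sym, prv_addS|].
  apply prv_eq_add; [apply P_EqI|apply prv_eq_sym, prv_addS].
Qed.

Lemma prv_add_succ_swap G t u :
  prv T G (Eq (Add t (Succ u)) (Add (Succ t) u)).
Proof. eapply prv_eq_trans; [apply prv_addS|apply prv_eq_sym, prv_Sadd]. Qed.

(** With [u] as an accumulator, lowering the second factor of a product only adds [x] to the
    accumulator. *)
Lemma prv_mulS_add G x y u :
  prv T G (Eq (Add (Mul x (Succ y)) u) (Add (Mul x y) (Add u x))).
Proof.
eapply prv_eq_trans; [apply prv_eq_add; [apply prv_mulS|apply P_EqI]|].
eapply prv_eq_trans; [apply prv_add_assoc|].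
apply prv_eq_add; [apply P_EqI|apply prv_add_comm].
Qed.

Lemma prv_mul0_add G x u : prv T G (Eq (Add (Mul x Zero) u) u).
Proof.
eapply prv_eq_trans; [apply prv_eq_add; [apply prv_mul0|apply P_EqI]|].
apply prv_0add.
Qed.

(** This links the two ways to quote a formula without dotted variables: [gdot 0 p] is a closed
    polynomial term, [quote p] the numeral of its value. *)
Lemma prv_eq_num_teval v t : tbound 0 t -> T |-- Eq t (num (teval v t)).
Proof.
assert (add : forall a b, T |-- Eq (Add (num a) (num b)) (num (a + b))).
{ intros a b; rewrite Nat.add_comm; induction b as [|b IH]; [apply prv_add0|].
  eapply prv_eq_trans; [apply prv_addS|apply prv_eq_succ, IH]. }
assert (mul : forall a b, T |-- Eq (Mul (num a) (num b)) (num (a * b))).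
{ intros a b; induction b as [|b IH].
  - rewrite Nat.mul_0_r; apply prv_mul0.
  - rewrite Nat.mul_succ_r.
    eapply prv_eq_trans; [apply prv_mulS|].
    eapply prv_eq_trans; [apply prv_eq_add; [apply IH|apply P_EqI]|apply add]. }
induction t; simpl; intros H.
- lia.
- apply P_EqI.
- apply prv_eq_succ, IHt, H.
- destruct H as [H1 H2]; eapply prv_eq_trans; [|apply add].
  apply prv_eq_add; [apply IHt1, H1|apply IHt2, H2].
- destruct H as [H1 H2]; eapply prv_eq_trans; [|apply mul].
  apply prv_eq_mul; [apply IHt1, H1|apply IHt2, H2].
Qed.

(** * Order and bounded quantifiers *)

Lemma prv_0le G t : prv T G (Le Zero t).
Proof. apply prv_leI with t, prv_add0. Qed.

Lemma prv_succ_nle0 G t : prv T G (Neg (Le (Succ t) Zero)).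
Proof.
apply P_ImpI; eapply prv_leE; [apply prv_hyp0|].
eapply P_ImpE; [apply prv_succ_neq0|].
eapply prv_eq_trans; [apply prv_eq_sym, prv_addS|apply prv_hyp0].
Qed.

Lemma prv_le_succ_succ G t u : prv T G (Iff (Le (Succ t) (Succ u)) (Le t u)).
Proof.
apply P_AndI; apply P_ImpI; (eapply prv_leE; [apply prv_hyp0|]).
- apply prv_leI with (Var 0), prv_succ_inj.
  eapply prv_eq_trans; [apply prv_eq_sym, prv_addS|apply prv_hyp0].
- apply prv_leI with (Var 0).
  eapply prv_eq_trans; [apply prv_addS|apply prv_eq_succ, prv_hyp0].
Qed.

Lemma prv_eq_succ_succ G t u : prv T G (Iff (Eq (Succ t) (Succ u)) (Eq t u)).
Proof.
apply P_AndI; apply P_ImpI.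
- apply prv_succ_inj, prv_hyp0.
- apply prv_eq_succ, prv_hyp0.
Qed.

Lemma prv_neq_zero_succ G t : prv T G (Neg (Eq Zero (Succ t))).
Proof.
apply P_ImpI; eapply P_ImpE; [apply prv_succ_neq0|apply prv_eq_sym, prv_hyp0].
Qed.

Lemma prv_le_refl G t : prv T G (Le t t).
Proof. apply prv_leI with Zero, prv_0add. Qed.

Lemma prv_le0 G t : prv T G (Le t Zero) -> prv T G (Eq t Zero).
Proof.
apply P_ImpE.
apply (proves_subst HT (fun _ => t) G (Imp (Le (Var 0) Zero) (Eq (Var 0) Zero))).
apply proves_cases; simpl; apply P_ImpI.
- apply P_EqI.
- apply prv_exfalso; eapply P_ImpE; [apply prv_succ_nle0|apply prv_hyp0].
Qed.

Lemma prv_leS G t u :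
  prv T G (Le t (Succ u)) -> prv T G (Or (Le t u) (Eq t (Succ u))).
Proof.
intros H; apply prv_leE with (1 := H).
change (prv T (Eq (Add (Var 0) (tshift t)) (Succ (tshift u)) :: map shift G)
  (Or (Le (tshift t) (tshift u)) (Eq (tshift t) (Succ (tshift u))))).
eapply P_ImpE; [|apply prv_hyp0].
apply (proves_subst HT (scons (Var 0) (scons (tshift t) (fun _ => tshift u))) _
  (Imp (Eq (Add (Var 0) (Var 1)) (Succ (Var 2)))
       (Or (Le (Var 1) (Var 2)) (Eq (Var 1) (Succ (Var 2)))))).
apply proves_cases; simpl; apply P_ImpI.
- apply P_OrI2.
  eapply prv_eq_trans; [apply prv_eq_sym, prv_0add|apply prv_hyp0].
- apply P_OrI1, prv_leI with (Var 0), prv_succ_inj.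
  eapply prv_eq_trans; [apply prv_eq_sym, prv_Sadd|apply prv_hyp0].
Qed.

Lemma prv_le_succ G t u : prv T G (Le t u) -> prv T G (Le t (Succ u)).
Proof.
intros H; apply prv_leE with (1 := H).
apply prv_leI with (Succ (Var 0)).
eapply prv_eq_trans; [apply prv_Sadd|apply prv_eq_succ, prv_hyp0].
Qed.

Definition ball (t : term) (p : form) : form :=
  All (Imp (Le (Var 0) (tshift t)) p).

Lemma tshift_inst t u : tsubst (scons u Var) (tshift t) = t.
Proof. unfold tshift; rewrite tsubst_comp; apply tsubst_Var. Qed.

Lemma prv_ballE G t p u :
  prv T G (ball t p) -> prv T G (Le u t) -> prv T G (inst p u).
Proof.
intros H; apply P_ImpE.
generalize (P_AllE T G _ u H); unfold inst; simpl; now rewrite tshift_inst.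
Qed.

Lemma shift_inst p t :
  shift (inst p t) = subst (scons (tshift t) (fun i => Var (S i))) p.
Proof.
unfold shift, inst; rewrite subst_comp; apply subst_ext; now intros [].
Qed.

Lemma subst_scons_Var0 p : subst (scons (Var 0) (fun i => Var (S i))) p = p.
Proof. rewrite (subst_ext _ Var); [apply subst_Var|now intros []]. Qed.

Lemma prv_eq_inst G t p :
  prv T G (Eq (Var 0) (tshift t)) -> prv T G (shift (inst p t)) -> prv T G p.
Proof.
rewrite shift_inst; intros H1 H2; rewrite <- (subst_scons_Var0 p).
apply prv_eq_subst with (tshift t); [apply prv_eq_sym|]; assumption.
Qed.

Lemma prv_ball0 G p : prv T G (Iff (ball Zero p) (inst p Zero)).
Proof.
apply P_AndI; apply P_ImpI.
- apply prv_ballE with Zero; [apply prv_hyp0|apply prv_0le].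
- apply P_AllI, P_ImpI, prv_eq_inst with Zero.
  + apply prv_le0, prv_hyp0.
  + apply prv_weaken1, prv_hyp0.
Qed.

Lemma prv_shift_ballE G t p :
  prv T G (shift (ball t p)) -> prv T G (Le (Var 0) (tshift t)) -> prv T G p.
Proof.
intros H; apply P_ImpE.
generalize (P_AllE T G (subst (up (fun i => Var (S i)))
  (Imp (Le (Var 0) (tshift t)) p)) (Var 0) H).
rewrite <- subst_scons, subst_scons_Var0; auto.
Qed.

Lemma prv_ballS G t p :
  prv T G (Iff (ball (Succ t) p) (And (ball t p) (inst p (Succ t)))).
Proof.
apply P_AndI; apply P_ImpI; [apply P_AndI|].
- apply P_AllI, P_ImpI, prv_shift_ballE with (Succ t).
  + apply prv_weaken1, prv_hyp0.
  + apply prv_le_succ, prv_hyp0.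
- apply prv_ballE with (Succ t); [apply prv_hyp0|apply prv_le_refl].
- apply P_AllI, P_ImpI.
  eapply P_OrE; [apply prv_leS, prv_hyp0| |].
  + apply prv_shift_ballE with t; [|apply prv_hyp0].
    do 2 apply prv_weaken1; eapply P_AndE1, prv_hyp0.
  + apply prv_eq_inst with (Succ t); [apply prv_hyp0|].
    do 2 apply prv_weaken1; eapply P_AndE2, prv_hyp0.
Qed.

Lemma prv_bex G t p :
  prv T G (Iff (Ex (And (Le (Var 0) (tshift t)) p)) (Neg (ball t (Neg p)))).
Proof.
apply P_AndI; apply P_ImpI.
- apply P_ImpI; eapply P_ExE; [apply prv_weaken1, prv_hyp0|].
  apply P_ImpE with p; [|eapply P_AndE2, prv_hyp0].
  apply prv_shift_ballE with t; [|eapply P_AndE1, prv_hyp0].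
  apply prv_weaken1, prv_hyp0.
- apply P_Raa; apply P_ImpE with (ball t (Neg p)); [apply prv_weaken1, prv_hyp0|].
  apply P_AllI, P_ImpI, P_ImpI.
  set (q := And _ p).
  apply P_ImpE with (shift (Ex q)); [do 2 apply prv_weaken1; apply prv_hyp0|].
  apply (P_ExI T _ (subst (up (fun i => Var (S i))) q) (Var 0)).
  rewrite <- subst_scons, subst_scons_Var0.
  apply P_AndI; [apply prv_weaken1|]; apply prv_hyp0.
Qed.

End Arithmetic.

Lemma fbound_alln m n p : fbound (n + m) p -> fbound m (alln n p).
Proof.
revert m; induction n as [|n IH]; intros m H; [exact H|].
change (fbound (S m) (alln n p)); apply IH.
now replace (n + S m) with (S n + m) by lia.
Qed.

Lemma stronger_refl T : stronger T T.
Proof. exact (fun p H => H). Qed.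

Lemma PA_sentences : sentences PA.
Proof.
intros _ [| | | | | | |n p Hp]; simpl; try lia.
apply fbound_alln; rewrite Nat.add_0_r; unfold induction, inst; simpl.
repeat split; try assumption; eapply fbound_subst; try eassumption;
  intros [|i] Hi; simpl; lia.
Qed.

(** * Substitution of numerals in dotted formulas *)

(* The substitutions that commute syntactically with [gdot]: a successor or a
   numeral put for a dotted variable is absorbed by the numeral it stands for. *)
Definition dotted (m n : nat) (s : nat -> term) : Prop :=
  (forall i, i < n ->
    exists k, s i = num k \/ exists j, j < m /\ s i = Nat.iter k Succ (Var j)) /\
  (forall i, n <= i -> s i = Var (i - n + m)).

Lemma tsubst_iter_Succ s k t :
  tsubst s (Nat.iter k Succ t) = Nat.iter k Succ (tsubst s t).
Proof. induction k as [|k IH]; simpl; congruence. Qed.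

Lemma iter_up s l i :
  Nat.iter l up s i =
  if i <? l then Var i else tsubst (fun j => Var (j + l)) (s (i - l)).
Proof.
revert i; induction l as [|l IH]; intros i.
- simpl; rewrite Nat.sub_0_r, (tsubst_ext _ Var), tsubst_Var; auto.
- destruct i as [|i]; [reflexivity|].
  change (tshift (Nat.iter l up s i) =
    if i <? l then Var (S i) else tsubst (fun j => Var (j + S l)) (s (i - l))).
  rewrite IH; destruct (i <? l); [reflexivity|].
  unfold tshift; rewrite tsubst_comp; apply tsubst_ext; simpl; auto.
Qed.

Lemma gdot_term_iter_Succ n l k j t :
  gdot_term n l k (Nat.iter j Succ t) = gdot_term n l (j + k) t.
Proof.
revert k; induction j as [|j IH]; intros k; [reflexivity|].
change (gdot_term n l (S k) (Nat.iter j Succ t) = gdot_term n l (S j + k) t).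
rewrite IH; f_equal; lia.
Qed.

Lemma tsubst_tpair s a b :
  tsubst s (tpair a b) = tpair (tsubst s a) (tsubst s b).
Proof. reflexivity. Qed.

Lemma gdot_term_tsubst m n s l k t :
  dotted m n s ->
  gdot_term m l k (tsubst (Nat.iter l up s) t) = tsubst s (gdot_term n l k t).
Proof.
intros [Hs Hs']; revert k; induction t; intros k; cbn [gdot_term tsubst];
  rewrite ?tsubst_tpair, ?tsubst_num, ?IHt1, ?IHt2; auto.
rewrite iter_up; destruct (Nat.ltb_spec i l) as [Hl|Hl].
- cbn [gdot_term]; destruct (Nat.ltb_spec i l); [|lia].
  now rewrite tsubst_tpair, !tsubst_num.
- destruct (Nat.ltb_spec i (l + n)) as [Hn|Hn].
  (* For a dotted variable, the successors of its image join the [k] successors already counted in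
     the same component of the code. *)
  + rewrite tsubst_tpair, tsubst_num, tsubst_iter_Succ; cbn [tsubst].
    destruct (Hs (i - l)) as [j [->|[r [Hr ->]]]]; [lia| |].
    * rewrite tsubst_num; unfold num; rewrite gdot_term_iter_Succ.
      rewrite <- Nat.iter_add, (Nat.add_comm k j); reflexivity.
    * rewrite tsubst_iter_Succ, gdot_term_iter_Succ; cbn [gdot_term tsubst].
      destruct (Nat.ltb_spec (r + l) l); [lia|].
      destruct (Nat.ltb_spec (r + l) (l + m)); [|lia].
      rewrite <- Nat.iter_add, (Nat.add_comm k j), Nat.add_sub; reflexivity.
  + rewrite Hs' by lia; cbn [gdot_term tsubst].
    destruct (Nat.ltb_spec (i - l - n + m + l) l); [lia|].
    destruct (Nat.ltb_spec (i - l - n + m + l) (l + m)); [lia|].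
    rewrite tsubst_tpair, !tsubst_num; do 3 f_equal; lia.
Qed.

Lemma gdot_subst m n s p :
  dotted m n s -> gdot m (subst s p) = tsubst s (gdot n p).
Proof.
intros Hs; unfold gdot; change s with (Nat.iter 0 up s) at 1.
generalize 0 as l; induction p; intros l; cbn [gdot_form subst];
  change (up (Nat.iter l up s)) with (Nat.iter (S l) up s);
  rewrite ?IHp1, ?IHp2, ?IHp, ?tsubst_tpair, ?tsubst_num,
    ?(gdot_term_tsubst m n s) by exact Hs; reflexivity.
Qed.

Definition ite (c p q : form) : form := Or (And c p) (And (Neg c) q).

Lemma subst_ite s c p q :
  subst s (ite c p q) = ite (subst s c) (subst s p) (subst s q).
Proof. reflexivity. Qed.

Ltac split_var i tac :=
  solve [tac ()
    | destruct i as [|i]; [tac () | solve [tac ()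
    | destruct i as [|i]; [tac () | solve [tac ()
    | destruct i as [|i]; [tac () | solve [tac ()
    | destruct i as [|i]; [tac () | tac ()]]]]]]]].

Ltac dotted_tac :=
  split; intros i Hi; split_var i ltac:(fun _ => simpl;
    solve [lia | f_equal; lia | exists 0; left; reflexivity
      | exists 0; right; eexists; split; [|reflexivity]; lia
      | exists 1; right; eexists; split; [|reflexivity]; lia]).

Ltac pointwise :=
  let i := fresh "i" in
  intros i; intros; split_var i ltac:(fun _ => simpl; solve [reflexivity | lia]).

Ltac subst_eq :=
  rewrite ?subst_comp; apply subst_ext; pointwise.

(** * Provability of formulas at the numerals of given values *)

Section Provability.
Context (U T : form -> Prop) (HU : sentences U) (HT : sentences T)
  (UPA : stronger U PA) (TPA : stronger T PA)
  (Pr : form) (HPr : fbound 1 Pr) (EU : cond_EU U T Pr).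

(** [Pr] of the formula p(s_0, ..., s_{n-1}), where s_0, ..., s_{n-1} are read
    as the numerals of the values of these terms. *)
Definition PrD (s : nat -> term) (n : nat) (p : form) : form :=
  inst Pr (tsubst s (gdot n p)).

Lemma PrD_ext s s' n p :
  (forall i, i < n -> s i = s' i) -> PrD s n p = PrD s' n p.
Proof.
intros H; unfold PrD; f_equal; eapply tsubst_ext_bound; [apply gdot_bound|auto].
Qed.

Lemma subst_PrD r s n p : subst r (PrD s n p) = PrD (fun i => tsubst r (s i)) n p.
Proof.
unfold PrD; rewrite <- tsubst_comp; unfold inst; rewrite subst_comp.
eapply subst_ext_bound; [exact HPr|]; intros [|i] Hi; [reflexivity|lia].
Qed.

Lemma PrD_Var n p : PrD Var n p = inst Pr (gdot n p).
Proof. unfold PrD; now rewrite tsubst_Var. Qed.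

(** Numerals and successors pass between the values and the quoted formula by syntactic identity of
    the Goedel terms. *)
Lemma PrD_dotted s s' m n r p :
  dotted m n r -> (forall i, i < n -> s i = tsubst s' (r i)) ->
  PrD s n p = PrD s' m (subst r p).
Proof.
intros Hr H; unfold PrD; rewrite (gdot_subst m n r p Hr), tsubst_comp.
f_equal; eapply tsubst_ext_bound; [apply gdot_bound|auto].
Qed.

Lemma PrD_iff G s n p q :
  T |-- Iff p q -> prv U G (Iff (PrD s n p) (PrD s n q)).
Proof.
intros H.
pose proof (alln_E HU n _ (EU n p q (alln_I n _ H))) as H'.
apply (proves_subst HU s G) in H'.
change (prv U G (Iff (subst s (inst Pr (gdot n p))) (subst s (inst Pr (gdot n q)))))
  in H'.
rewrite <- !PrD_Var in H'; rewrite !subst_PrD in H'; exact H'.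
Qed.

(** Here [T] proves the equation and it is used inside the quotation. In [PrD_eq] it may depend on
    hypotheses in [U], but then it only changes the value whose numeral is quoted. *)
Lemma PrD_eq_iff G s r n t u p :
  T |-- Eq t u ->
  prv U G (Iff (PrD s n (subst (scons t r) p)) (PrD s n (subst (scons u r) p))).
Proof. intros H; now apply PrD_iff, prv_eq_iff. Qed.

Lemma PrD_eq G s n t u p :
  prv U G (Eq t u) ->
  prv U G (Iff (PrD (scons t s) n p) (PrD (scons u s) n p)).
Proof.
intros H; apply (prv_eq_iff G t u s (PrD Var n p)) in H.
rewrite !subst_PrD in H; exact H.
Qed.

(** * Evaluation of sums, products and terms inside the quotation *)

Definition add_ctx (p : form) : form :=
  subst (scons (Add (Var 1) (Var 0)) (fun i => Var (2 + i))) p.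

Lemma PrD_add0 G a s n p :
  prv U G (Iff (PrD (scons Zero (scons a s)) (2 + n) (add_ctx p))
               (PrD (scons (Add a Zero) s) (1 + n) p)).
Proof.
rewrite (PrD_dotted _ (scons a s) (1 + n) (2 + n) (scons Zero Var));
  [|dotted_tac|pointwise].
replace (subst (scons Zero Var) (add_ctx p))
  with (subst (scons (Add (Var 0) Zero) (fun i => Var (S i))) p)
  by (unfold add_ctx; subst_eq).
eapply iff_trans; [apply PrD_eq_iff, prv_add0; assumption|].
rewrite subst_scons_Var0.
apply PrD_eq, prv_eq_sym, prv_add0; assumption.
Qed.

(** Pulling the successors into the quoted formula brings both sides over the same values [a] and
    [b]; there they differ by the [T]-provable equation a + s(b) = s(a) + b. *)
Lemma PrD_addS G a b s n p :
  prv U G (Iff (PrD (scons (Succ b) (scons a s)) (2 + n) (add_ctx p))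
               (PrD (scons b (scons (Succ a) s)) (2 + n) (add_ctx p))).
Proof.
rewrite (PrD_dotted _ (scons b (scons a s)) (2 + n) (2 + n)
  (scons (Succ (Var 0)) (fun i => Var (S i)))); [|dotted_tac|pointwise].
rewrite (PrD_dotted (scons b (scons (Succ a) s)) (scons b (scons a s))
  (2 + n) (2 + n) (scons (Var 0) (scons (Succ (Var 1)) (fun i => Var (2 + i)))));
  [|dotted_tac|pointwise].
replace (subst (scons (Succ (Var 0)) _) (add_ctx p))
  with (subst (scons (Add (Var 1) (Succ (Var 0))) (fun i => Var (2 + i))) p)
  by (unfold add_ctx; subst_eq).
replace (subst (scons (Var 0) _) (add_ctx p))
  with (subst (scons (Add (Succ (Var 1)) (Var 0)) (fun i => Var (2 + i))) p)
  by (unfold add_ctx; subst_eq).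
apply PrD_eq_iff, prv_add_succ_swap; assumption.
Qed.

(** The left side quotes a sum of two numerals, the right side the single numeral of the value of
    the sum. *)
Definition add_claim (a b : term) (s : nat -> term) (n : nat) (p : form) : form :=
  Iff (PrD (scons b (scons a s)) (2 + n) (add_ctx p))
      (PrD (scons (Add a b) s) (1 + n) p).

Lemma subst_add_claim r a b s n p :
  subst r (add_claim a b s n p) =
  add_claim (tsubst r a) (tsubst r b) (fun i => tsubst r (s i)) n p.
Proof.
unfold add_claim, Iff; cbn [subst]; rewrite !subst_PrD.
rewrite (PrD_ext (fun i => tsubst r (scons b (scons a s) i))
  (scons (tsubst r b) (scons (tsubst r a) (fun i => tsubst r (s i)))))
  by now intros [|[|i]].
rewrite (PrD_ext (fun i => tsubst r (scons (Add a b) s i))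
  (scons (Add (tsubst r a) (tsubst r b)) (fun i => tsubst r (s i))))
  by now intros [|i].
reflexivity.
Qed.

(* The induction on [b] moves successors from [b] to [a], so [a] is quantified
   in the induction formula. *)
Lemma PrD_add G a b s n p : prv U G (add_claim a b s n p).
Proof.
assert (H : U |-- All (add_claim (Var 0) (Var 1) (fun i => Var (2 + i)) n p)).
{ apply proves_induction; try assumption.
  - unfold inst; cbn [subst]; apply P_AllI; rewrite subst_add_claim.
    apply PrD_add0.
  - cbn [subst]; apply P_AllI; rewrite subst_add_claim.
    cbn [map]; unfold shift; cbn [subst]; rewrite subst_add_claim.
    set (A := add_claim _ _ _ _ _).
    eapply iff_trans; [apply PrD_addS|].
    eapply iff_trans; [|apply PrD_eq, prv_eq_sym, prv_add_succ_swap; assumption].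
    generalize (P_AllE U _ _ (Succ (Var 0)) (prv_hyp0 nil (All A))).
    unfold inst, A; rewrite subst_add_claim; exact (fun H => H). }
apply (alln_E HU 1) in H.
apply (proves_subst HU (scons a (scons b s)) G) in H.
rewrite subst_add_claim in H; exact H.
Qed.

(* [Var 2], [Var 1] and [Var 0] are the factors and an accumulator. *)
Definition mul_ctx (p : form) : form :=
  subst (scons (Add (Mul (Var 2) (Var 1)) (Var 0)) (fun i => Var (3 + i))) p.

Lemma PrD_mul0 G x u s n p :
  prv U G (Iff (PrD (scons u (scons Zero (scons x s))) (3 + n) (mul_ctx p))
               (PrD (scons (Add (Mul x Zero) u) s) (1 + n) p)).
Proof.
rewrite (PrD_dotted _ (scons u (scons x s)) (2 + n) (3 + n)
  (scons (Var 0) (scons Zero (fun i => Var (S i))))); [|dotted_tac|pointwise].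
replace (subst _ (mul_ctx p))
  with (subst (scons (Add (Mul (Var 1) Zero) (Var 0)) (fun i => Var (2 + i))) p)
  by (unfold mul_ctx; subst_eq).
eapply iff_trans; [apply PrD_eq_iff, prv_mul0_add; assumption|].
(* The factor [x] no longer occurs in the quoted formula, so its place is dropped from the dotted
   variables. *)
rewrite <- (PrD_dotted (scons u s) (scons u (scons x s)) (2 + n) (1 + n)
  (scons (Var 0) (fun i => Var (2 + i)))); [|dotted_tac|pointwise].
apply PrD_eq, prv_eq_sym, prv_mul0_add; assumption.
Qed.

Lemma PrD_mulS G x y u s n p :
  prv U G (Iff (PrD (scons u (scons (Succ y) (scons x s))) (3 + n) (mul_ctx p))
               (PrD (scons (Add u x) (scons y (scons x s))) (3 + n) (mul_ctx p))).
Proof.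
rewrite (PrD_dotted _ (scons u (scons y (scons x s))) (3 + n) (3 + n)
  (scons (Var 0) (scons (Succ (Var 1)) (fun i => Var (2 + i)))));
  [|dotted_tac|pointwise].
replace (subst _ (mul_ctx p))
  with (subst (scons (Add (Mul (Var 2) (Succ (Var 1))) (Var 0))
    (fun i => Var (3 + i))) p) by (unfold mul_ctx; subst_eq).
eapply iff_trans; [apply PrD_eq_iff, prv_mulS_add; assumption|].
eapply iff_trans; [|apply PrD_add].
(* [PrD_add] gives the addend [x] a place of its own, which is identified with the place of the
   factor [x], index 2 after [u] and [y]. *)
rewrite (PrD_dotted (scons x _) (scons u (scons y (scons x s))) (3 + n) (4 + n)
  (scons (Var 2) Var)); [|dotted_tac|pointwise].
replace (subst (scons (Var 2) _) (add_ctx (mul_ctx p)))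
  with (subst (scons (Add (Mul (Var 2) (Var 1)) (Add (Var 0) (Var 2)))
    (fun i => Var (3 + i))) p) by (unfold add_ctx, mul_ctx; subst_eq).
apply iff_refl.
Qed.

Definition mul_claim (x y u : term) (s : nat -> term) (n : nat) (p : form) : form :=
  Iff (PrD (scons u (scons y (scons x s))) (3 + n) (mul_ctx p))
      (PrD (scons (Add (Mul x y) u) s) (1 + n) p).

Lemma subst_mul_claim r x y u s n p :
  subst r (mul_claim x y u s n p) =
  mul_claim (tsubst r x) (tsubst r y) (tsubst r u) (fun i => tsubst r (s i)) n p.
Proof.
unfold mul_claim, Iff; cbn [subst]; rewrite !subst_PrD.
rewrite (PrD_ext (fun i => tsubst r (scons u (scons y (scons x s)) i))
  (scons (tsubst r u) (scons (tsubst r y) (scons (tsubst r x)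
    (fun i => tsubst r (s i)))))) by now intros [|[|[|i]]].
rewrite (PrD_ext (fun i => tsubst r (scons (Add (Mul x y) u) s i))
  (scons (Add (Mul (tsubst r x) (tsubst r y)) (tsubst r u))
    (fun i => tsubst r (s i)))) by now intros [|i].
reflexivity.
Qed.

(** Induction on [y] with the accumulator quantified: each step trades a successor of [y] for the
    addition of [x] to [u], and uses the hypothesis at the accumulator u + x. *)
Lemma PrD_mul_add G x y u s n p : prv U G (mul_claim x y u s n p).
Proof.
assert (H : U |--
  All (mul_claim (Var 2) (Var 1) (Var 0) (fun i => Var (3 + i)) n p)).
{ apply proves_induction; try assumption.
  - unfold inst; cbn [subst]; apply P_AllI; rewrite subst_mul_claim.
    apply PrD_mul0.
  - cbn [subst]; apply P_AllI; rewrite subst_mul_claim.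
    cbn [map]; unfold shift; cbn [subst]; rewrite subst_mul_claim.
    set (A := mul_claim _ _ _ _ _ _).
    eapply iff_trans; [apply PrD_mulS|].
    eapply iff_trans; [|apply PrD_eq, prv_eq_sym, prv_mulS_add; assumption].
    generalize (P_AllE U _ _ (Add (Var 0) (Var 2)) (prv_hyp0 nil (All A))).
    unfold inst, A; rewrite subst_mul_claim; exact (fun H => H). }
apply (alln_E HU 1) in H.
apply (proves_subst HU (scons u (scons y (scons x s))) G) in H.
rewrite subst_mul_claim in H; exact H.
Qed.

Lemma PrD_mul G a b s n p :
  prv U G (Iff
    (PrD (scons b (scons a s)) (2 + n)
       (subst (scons (Mul (Var 1) (Var 0)) (fun i => Var (2 + i))) p))
    (PrD (scons (Mul a b) s) (1 + n) p)).
Proof.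
eapply iff_trans; [|apply PrD_eq, prv_add0; assumption].
eapply iff_trans; [|apply PrD_mul_add].
rewrite (PrD_dotted (scons Zero _) (scons b (scons a s)) (2 + n) (3 + n)
  (scons Zero Var)); [|dotted_tac|pointwise].
replace (subst (scons Zero Var) (mul_ctx p))
  with (subst (scons (Add (Mul (Var 1) (Var 0)) Zero) (fun i => Var (2 + i))) p)
  by (unfold mul_ctx; subst_eq).
apply PrD_eq_iff, prv_eq_sym, prv_add0; assumption.
Qed.

Lemma tshift_ren f t :
  tshift (tsubst (fun i => Var (f i)) t) = tsubst (fun i => Var (S (f i))) t.
Proof. unfold tshift; now rewrite tsubst_comp. Qed.

(** In a sum or product, once the first operand has become a fresh dotted variable, the second one
    appears shifted. A shifted subterm is not a subterm, so the induction on [t] has to cover all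
    renamings of [t]. *)
Lemma PrD_inst_ren f t : forall n G s p,
  let t' := tsubst (fun i => Var (f i)) t in
  tbound n t' ->
  prv U G (Iff (PrD s n (inst p t')) (PrD (scons (tsubst s t') s) (1 + n) p)).
Proof.
assert (two : forall t u f n G s q,
  (forall n G s p, tbound n (tsubst (fun i => Var (f i)) t) ->
    prv U G (Iff (PrD s n (inst p (tsubst (fun i => Var (f i)) t)))
      (PrD (scons (tsubst s (tsubst (fun i => Var (f i)) t)) s) (1 + n) p))) ->
  (forall f n G s p, tbound n (tsubst (fun i => Var (f i)) u) ->
    prv U G (Iff (PrD s n (inst p (tsubst (fun i => Var (f i)) u)))
      (PrD (scons (tsubst s (tsubst (fun i => Var (f i)) u)) s) (1 + n) p))) ->
  let t' := tsubst (fun i => Var (f i)) t in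
  let u' := tsubst (fun i => Var (f i)) u in
  tbound n t' -> tbound n u' ->
  prv U G (Iff (PrD s n (subst (scons u' (scons t' Var)) q))
    (PrD (scons (tsubst s u') (scons (tsubst s t') s)) (2 + n) q))).
{ clear; intros t u f n G s q IHt IHu t' u' Ht Hu.
  replace (subst (scons u' (scons t' Var)) q)
    with (inst (inst q (tshift u')) t').
  2: { unfold inst; rewrite subst_comp; apply subst_ext; intros [|i];
       [apply tshift_inst|reflexivity]. }
  eapply iff_trans; [apply IHt, Ht|]; fold t'.
  assert (E : tsubst (scons (tsubst s t') s) (tshift u') = tsubst s u').
  { unfold tshift; rewrite tsubst_comp; reflexivity. }
  rewrite <- E; unfold u'; rewrite tshift_ren; apply IHu.
  rewrite <- tshift_ren; eapply tbound_tsubst; [exact Hu|simpl; lia]. }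
revert f; induction t as [i| |t IH|t IHt u IHu|t IHt u IHu];
  intros f n G s p; cbn [tsubst]; intros Hb.
- rewrite (PrD_dotted (scons _ s) s n (1 + n) (scons (Var (f i)) Var));
    [apply iff_refl| |pointwise].
  simpl in Hb; split; intros [|j] Hj; simpl.
  + exists 0; right; eauto.
  + exists 0; right; exists j; split; [lia|reflexivity].
  + lia.
  + f_equal; lia.
- rewrite (PrD_dotted (scons _ s) s n (1 + n) (scons Zero Var));
    [apply iff_refl|dotted_tac|pointwise].
- set (t' := tsubst _ t) in *.
  replace (inst p (Succ t'))
    with (inst (subst (scons (Succ (Var 0)) (fun i => Var (S i))) p) t')
    by (unfold inst; subst_eq).
  eapply iff_trans; [apply (IH f); exact Hb|]; fold t'.
  rewrite (PrD_dotted (scons (Succ _) s) (scons (tsubst s t') s) (1 + n) (1 + n)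
    (scons (Succ (Var 0)) (fun i => Var (S i))));
    [apply iff_refl|dotted_tac|pointwise].
- set (t' := tsubst _ t) in *; set (u' := tsubst _ u) in *; destruct Hb as [Ht Hu].
  eapply iff_trans; [|apply PrD_add].
  replace (inst p (Add t' u')) with (subst (scons u' (scons t' Var)) (add_ctx p))
    by (unfold add_ctx, inst; subst_eq).
  apply two; auto.
- set (t' := tsubst _ t) in *; set (u' := tsubst _ u) in *; destruct Hb as [Ht Hu].
  eapply iff_trans; [|apply PrD_mul].
  replace (inst p (Mul t' u')) with (subst (scons u' (scons t' Var))
    (subst (scons (Mul (Var 1) (Var 0)) (fun i => Var (2 + i))) p))
    by (unfold inst; subst_eq).
  apply two; auto.
Qed.

Lemma PrD_inst t n G s p :
  tbound n t ->
  prv U G (Iff (PrD s n (inst p t)) (PrD (scons (tsubst s t) s) (1 + n) p)).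
Proof.
intros H; pose proof (PrD_inst_ren (fun i => i) t n G s p) as H'.
cbv zeta in H'; rewrite tsubst_Var in H'; auto.
Qed.

(** * Formulas decided inside [Pr] *)

Lemma fbound_exn m n p : fbound (n + m) p <-> fbound m (exn n p).
Proof.
revert m; induction n as [|n IH]; intros m; [reflexivity|].
change (fbound (S n + m) p <-> fbound (S m) (exn n p)); rewrite <- IH.
now replace (n + S m) with (S n + m) by lia.
Qed.

Lemma tshift_tsubst s t : tshift (tsubst s t) = tsubst (up s) (tshift t).
Proof. unfold tshift; now rewrite !tsubst_comp. Qed.

Lemma Delta0_subst s p : Delta0 p -> Delta0 (subst s p).
Proof.
intros H; revert s; induction H; intros s; cbn [subst]; try constructor; auto.
- cbn [tsubst up scons]; rewrite <- tshift_tsubst; constructor; auto.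
- cbn [tsubst up scons]; rewrite <- tshift_tsubst; constructor; auto.
Qed.

Definition decides (c a p q : form) : form :=
  And (Imp c (Iff a p)) (Imp (Neg c) (Iff a q)).

Definition shiftn (k : nat) : form -> form := subst (fun i => Var (k + i)).

(* The branches [p] and [q] do not contain the first [k] variables: this keeps
   them fixed in an induction on one of these variables. *)
Definition decision (k n : nat) (c p q : form) (s : nat -> term) : form :=
  decides (subst s c) (PrD s (k + n) (ite c (shiftn k p) (shiftn k q)))
    (PrD (fun i => s (k + i)) n p) (PrD (fun i => s (k + i)) n q).

Definition decided (k n : nat) (c : form) : Prop :=
  forall p q G s, prv U G (decision k n c p q s).

Lemma shiftn0 p : shiftn 0 p = p.
Proof. apply subst_Var. Qed.

Lemma PrD_shiftn k n s p :
  PrD s (k + n) (shiftn k p) = PrD (fun i => s (k + i)) n p.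
Proof.
symmetry; apply PrD_dotted; [|reflexivity].
split; intros i Hi; [|f_equal; lia].
exists 0; right; exists (k + i); split; [lia|reflexivity].
Qed.

Lemma subst_decision r k n c p q s :
  subst r (decision k n c p q s) =
  decision k n c p q (fun i => tsubst r (s i)).
Proof.
unfold decision, decides, Iff, Neg; cbn [subst].
now rewrite !subst_comp, !subst_PrD.
Qed.

(** Numerals and successors in the first [k] places move from the values into the condition, while
    the branches do not contain these places. This performs the successor steps of the inductions on
    values. *)
Lemma decision_dotted k k' n r c p q s s' :
  dotted (k' + n) (k + n) r -> (forall i, r (k + i) = Var (k' + i)) ->
  (forall i, s i = tsubst s' (r i)) ->
  decision k n c p q s = decision k' n (subst r c) p q s'.
Proof.
intros Hr Hk Hs; unfold decision.
rewrite (PrD_dotted s s' _ _ r _ Hr) by auto.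
rewrite subst_ite, subst_comp, (subst_ext s _ c Hs).
assert (E : forall d, subst r (shiftn k d) = shiftn k' d).
{ intros d; unfold shiftn; rewrite subst_comp; apply subst_ext, Hk. }
assert (E' : forall d,
  PrD (fun i => s (k + i)) n d = PrD (fun i => s' (k' + i)) n d).
{ intros d; apply PrD_ext; intros i _; now rewrite Hs, Hk. }
now rewrite !E, !E'.
Qed.

Lemma decision_ext k n c p q G s s' :
  (forall i, s i = s' i) ->
  prv U G (decision k n c p q s) -> prv U G (decision k n c p q s').
Proof.
intros H; unfold decision; rewrite (subst_ext s s' c H).
rewrite (PrD_ext s s') by auto.
now rewrite !(PrD_ext (fun i => s (k + i)) (fun i => s' (k + i))) by auto.
Qed.

Lemma decided_open k n c :
  (forall p q, U |-- decision k n c p q Var) -> decided k n c.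
Proof.
intros H p q G s; generalize (proves_subst HU s G _ (H p q)).
rewrite subst_decision; exact (fun H => H).
Qed.

(** The equivalence is used twice, in [U] outside the quotation and in [T] inside it; provability in
    [PA] serves both. *)
Lemma decision_iff k n c d p q G s :
  PA |-- Iff c d ->
  prv U G (decision k n c p q s) -> prv U G (decision k n d p q s).
Proof.
intros H H1.
pose proof (proves_subst HU s G _ (UPA _ H)) as H2; cbn [subst Iff] in H2.
assert (H3 : forall p q,
  prv U G (Iff (PrD s (k + n) (ite c p q)) (PrD s (k + n) (ite d p q)))).
{ intros p' q'; apply PrD_iff; unfold ite; ptaut (TPA _ H). }
unfold decision, decides in *; ptaut H1 H2 (H3 (shiftn k p) (shiftn k q)).
Qed.

Lemma decided_iff k n c d : PA |-- Iff c d -> decided k n c -> decided k n d.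
Proof. intros H Hc p q G s; eapply decision_iff; eauto. Qed.

Lemma decidedI k n c :
  (forall p q G s, prv U G (decides (subst s c)
     (PrD s (k + n) (ite c p q)) (PrD s (k + n) p) (PrD s (k + n) q))) ->
  decided k n c.
Proof.
intros H p q G s; unfold decision; rewrite <- !PrD_shiftn; apply H.
Qed.

Lemma decided0E n c p q G s :
  decided 0 n c ->
  prv U G (decides (subst s c) (PrD s n (ite c p q)) (PrD s n p) (PrD s n q)).
Proof.
intros H; generalize (H p q G s); unfold decision; rewrite !shiftn0.
exact (fun H => H).
Qed.

Lemma decided_true k n c : PA |-- c -> decided k n c.
Proof.
intros H; apply decidedI; intros p q G s.
pose proof (proves_subst HU s G _ (UPA _ H)) as H2.
assert (H3 : prv U G (Iff (PrD s (k + n) (ite c p q)) (PrD s (k + n) p))).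
{ apply PrD_iff; unfold ite; ptaut (TPA _ H). }
unfold decides; ptaut H2 H3.
Qed.

Lemma decided_false k n c : PA |-- Neg c -> decided k n c.
Proof.
intros H; apply decidedI; intros p q G s.
pose proof (proves_subst HU s G _ (UPA _ H)) as H2.
assert (H3 : prv U G (Iff (PrD s (k + n) (ite c p q)) (PrD s (k + n) q))).
{ apply PrD_iff; unfold ite; ptaut (TPA _ H). }
cbn [subst Neg] in H2; unfold decides; ptaut H2 H3.
Qed.

Lemma decided_Imp n c d :
  decided 0 n c -> decided 0 n d -> decided 0 n (Imp c d).
Proof.
intros Hc Hd; apply decidedI; intros p q G s; rewrite !Nat.add_0_l.
pose proof (decided0E n c (ite d p q) p G s Hc) as H1.
pose proof (decided0E n d p q G s Hd) as H2.
(* If [c], the implication is decided by [d]; otherwise it holds and the branch is [p]. *)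
assert (H3 : prv U G
  (Iff (PrD s n (ite (Imp c d) p q)) (PrD s n (ite c (ite d p q) p)))).
{ apply PrD_iff; unfold ite; ptaut. }
cbn [subst]; unfold decides in *; ptaut H1 H2 H3.
Qed.

Lemma decided_Neg n c : decided 0 n c -> decided 0 n (Neg c).
Proof.
intros H; apply decided_Imp; [exact H|].
apply decided_false, P_ImpI, prv_hyp0.
Qed.

(** In the induction on a bound, the hypothesis about [c] is available for the fixed branches [p]
    and [q] only. So [d], decided for all branches, is tested first, and [c] keeps its branches: if
    [d] then (if [c] then [p] else [q]) else [q]. *)
Lemma decision_And k n c d p q G s :
  prv U G (decision k n c p q s) -> decided 0 (k + n) d ->
  prv U G (decision k n (And c d) p q s).
Proof.
intros H1 Hd.
pose proof (decided0E _ d (ite c (shiftn k p) (shiftn k q)) (shiftn k q) G s Hd)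
  as H2.
rewrite (PrD_shiftn k n s q) in H2.
assert (H3 : forall p q, prv U G (Iff (PrD s (k + n) (ite (And c d) p q))
  (PrD s (k + n) (ite d (ite c p q) q)))).
{ intros p' q'; apply PrD_iff; unfold ite; ptaut. }
unfold decision, decides in *; cbn [subst].
ptaut H1 H2 (H3 (shiftn k p) (shiftn k q)).
Qed.

Lemma decided_And n c d :
  decided 0 n c -> decided 0 n d -> decided 0 n (And c d).
Proof. intros Hc Hd p q G s; apply decision_And; auto. Qed.

Lemma decided_Or n c d :
  decided 0 n c -> decided 0 n d -> decided 0 n (Or c d).
Proof.
intros Hc Hd; apply decided_iff with (Imp (Neg c) d); [ptaut|].
auto using decided_Imp, decided_Neg.
Qed.

Lemma decided_inst k n c t :
  tbound (k + n) t -> decided (1 + k) n c -> decided k n (inst c t).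
Proof.
intros Ht Hc p q G s.
pose proof (Hc p q G (scons (tsubst s t) s)) as H1.
pose proof (PrD_inst t (k + n) G s
  (ite c (shiftn (1 + k) p) (shiftn (1 + k) q)) Ht) as H2.
assert (E : forall r, subst (scons t Var) (shiftn (1 + k) r) = shiftn k r).
{ intros r; unfold shiftn; rewrite subst_comp; apply subst_ext; reflexivity. }
unfold inst in H2; rewrite subst_ite, !E in H2.
change (prv U G (decides (subst (scons (tsubst s t) s) c)
  (PrD (scons (tsubst s t) s) (1 + (k + n))
     (ite c (shiftn (1 + k) p) (shiftn (1 + k) q)))
  (PrD (fun i => s (k + i)) n p) (PrD (fun i => s (k + i)) n q))) in H1.
unfold decision, inst.
replace (subst s (subst (scons t Var) c)) with (subst (scons (tsubst s t) s) c)
  by (rewrite subst_comp; apply subst_ext; now intros [|i]).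
unfold decides in *; ptaut H1 H2.
Qed.

(** * Atomic formulas and bounded quantifiers *)

(** When one argument is 0, [PA] settles the atom according to whether the other is 0 or a
    successor; two successors are stripped together. This is all that a double induction in [U]
    needs. *)
Lemma decided_atom n c :
  PA |-- subst (scons Zero (scons Zero Var)) c \/
  PA |-- Neg (subst (scons Zero (scons Zero Var)) c) ->
  PA |-- subst (scons (Succ (Var 0)) (scons Zero (fun i => Var (S i)))) c \/
  PA |-- Neg (subst (scons (Succ (Var 0)) (scons Zero (fun i => Var (S i)))) c) ->
  PA |-- subst (scons Zero (scons (Succ (Var 0)) (fun i => Var (S i)))) c \/
  PA |-- Neg (subst (scons Zero (scons (Succ (Var 0)) (fun i => Var (S i)))) c) ->
  PA |-- Iff c
    (subst (scons (Succ (Var 0)) (scons (Succ (Var 1)) (fun i => Var (2 + i)))) c) ->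
  decided 2 n c.
Proof.
intros h00 h0S hS0 hSS; apply decided_open; intros p q.
assert (dec : forall k d, PA |-- d \/ PA |-- Neg d -> decided k n d).
{ intros k d []; auto using decided_true, decided_false. }
assert (k00 : forall G s,
  prv U G (decision 2 n c p q (scons Zero (scons Zero s)))).
{ intros G s.
  rewrite (decision_dotted 2 0 n (scons Zero (scons Zero Var)) _ _ _ _ s);
    [apply dec, h00|dotted_tac|reflexivity|now intros [|[|i]]]. }
assert (k0S : forall G b s,
  prv U G (decision 2 n c p q (scons (Succ b) (scons Zero s)))).
{ intros G b s.
  rewrite (decision_dotted 2 1 n (scons (Succ (Var 0)) (scons Zero
    (fun i => Var (S i)))) _ _ _ _ (scons b s));
    [apply dec, h0S|dotted_tac|reflexivity|now intros [|[|i]]]. }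
assert (kS0 : forall G a s,
  prv U G (decision 2 n c p q (scons Zero (scons (Succ a) s)))).
{ intros G a s.
  rewrite (decision_dotted 2 1 n (scons Zero (scons (Succ (Var 0))
    (fun i => Var (S i)))) _ _ _ _ (scons a s));
    [apply dec, hS0|dotted_tac|reflexivity|now intros [|[|i]]]. }
assert (kSS : forall G a b s,
  prv U G (decision 2 n c p q (scons b (scons a s))) ->
  prv U G (decision 2 n c p q (scons (Succ b) (scons (Succ a) s)))).
{ intros G a b s H.
  rewrite (decision_dotted 2 2 n (scons (Succ (Var 0)) (scons (Succ (Var 1))
    (fun i => Var (2 + i)))) _ _ _ _ (scons b (scons a s)));
    [eapply decision_iff; eauto|dotted_tac|reflexivity|now intros [|[|i]]]. }
apply (alln_E HU 1); change (U |-- All (decision 2 n c p q Var)).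
(* Induction on [Var 1] with [Var 0] quantified, since the hypothesis is needed at the predecessor
   of [Var 0]; the inner inductions only distinguish 0 from successors. *)
apply (alln_E HU 1), prv_induction; try assumption.
- unfold inst; cbn [subst]; rewrite subst_decision.
  apply prv_induction; try assumption.
  + unfold inst; rewrite subst_decision.
    apply decision_ext with (scons Zero (scons Zero Var));
      [now intros [|[|i]]|].
    apply k00.
  + rewrite subst_decision.
    apply decision_ext with (scons (Succ (Var 0)) (scons Zero (fun i => Var (S i))));
      [now intros [|[|i]]|].
    apply k0S.
- cbn [subst]; rewrite subst_decision; apply prv_induction; try assumption.
  + unfold inst; rewrite subst_decision.
    apply decision_ext with (scons Zero (scons (Succ (Var 0)) (fun i => Var (S i))));
      [now intros [|[|i]]|].
    apply kS0.
  + rewrite subst_decision.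
    apply decision_ext with
      (scons (Succ (Var 0)) (scons (Succ (Var 1)) (fun i => Var (2 + i))));
      [now intros [|[|i]]|].
    apply kSS, prv_weaken1.
    cbn [map]; unfold shift; cbn [subst]; rewrite subst_decision.
    set (s := fun i => _).
    generalize (P_AllE U _ _ (Var 0) (prv_hyp0 nil (All (decision 2 n c p q s)))).
    unfold inst; rewrite subst_decision; apply decision_ext.
    now intros [|[|i]].
Qed.

Lemma tbound_tshift n t : tbound (1 + n) (tshift t) <-> tbound n t.
Proof. induction t; simpl in *; intuition lia. Qed.

Lemma decided_Le n t u : tbound n t -> tbound n u -> decided 0 n (Le t u).
Proof.
intros Ht Hu.
replace (Le t u) with (inst (inst (Le (Var 1) (Var 0)) (tshift u)) t)
  by (unfold inst; simpl; now rewrite tshift_inst).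
apply decided_inst; [exact Ht|]; apply decided_inst; [now apply tbound_tshift|].
apply decided_atom; simpl.
- left; apply prv_0le; auto using PA_sentences, stronger_refl.
- left; apply prv_0le; auto using PA_sentences, stronger_refl.
- right; apply prv_succ_nle0; auto using PA_sentences, stronger_refl.
- apply iff_sym, prv_le_succ_succ; auto using PA_sentences, stronger_refl.
Qed.

Lemma decided_Eq n t u : tbound n t -> tbound n u -> decided 0 n (Eq t u).
Proof.
intros Ht Hu.
replace (Eq t u) with (inst (inst (Eq (Var 1) (Var 0)) (tshift u)) t)
  by (unfold inst; simpl; now rewrite tshift_inst).
apply decided_inst; [exact Ht|]; apply decided_inst; [now apply tbound_tshift|].
apply decided_atom; simpl.
- left; apply P_EqI.
- right; apply prv_neq_zero_succ; auto using PA_sentences, stronger_refl.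
- right; apply prv_succ_neq0; auto using PA_sentences, stronger_refl.
- apply iff_sym, prv_eq_succ_succ; auto using PA_sentences, stronger_refl.
Qed.

(** Induction in [U] on the bound, generalized to a dotted variable so that it can vary: at 0 a
    single instance of [p] remains, and a successor adds one instance as a conjunct. These instances
    are why [p] is assumed decided under substitutions. *)
Lemma decided_ball n t p :
  tbound n t -> fbound (1 + n) p ->
  (forall m r, fbound m (subst r p) -> decided 0 m (subst r p)) ->
  decided 0 n (ball t p).
Proof.
intros Ht Hp IH.
(* Index 0 stays the quantified variable; index 1 is freed for the bound. *)
set (p' := subst (scons (Var 0) (fun i => Var (2 + i))) p).
assert (E : forall u, inst (ball (Var 0) p') u = ball u p).
{ intros u; unfold ball, inst, p'; cbn [subst]; do 2 f_equal.
  rewrite subst_comp, (subst_ext _ Var), subst_Var; [reflexivity|].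
  now intros [|i]. }
rewrite <- E; apply decided_inst; [exact Ht|]; change (1 + 0) with 1.
apply decided_open; intros q q'; apply proves_induction; try assumption.
- unfold inst; rewrite subst_decision.
  rewrite (decision_dotted 1 0 n (scons Zero Var) _ _ _ _ Var);
    [|dotted_tac|reflexivity|now intros [|i]].
  fold (inst (ball (Var 0) p') Zero); rewrite E.
  apply decision_iff with (inst p Zero).
  + apply iff_sym, prv_ball0; auto using PA_sentences, stronger_refl.
  + apply IH; eapply fbound_subst; [exact Hp|].
    intros [|i] Hi; simpl; [exact I|lia].
- rewrite subst_decision.
  set (K := decision 1 n (ball (Var 0) p') q q' Var) at 1.
  rewrite (decision_dotted 1 1 n (scons (Succ (Var 0)) (fun i => Var (S i)))
    _ _ _ _ Var); [|dotted_tac|reflexivity|now intros [|i]].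
  replace (subst _ (ball (Var 0) p')) with (ball (Succ (Var 0)) p').
  2: { unfold ball, p'; cbn [subst]; do 2 f_equal; subst_eq. }
  apply decision_iff with (And (ball (Var 0) p') (inst p' (Succ (Var 0)))).
  + apply iff_sym, prv_ballS; auto using PA_sentences, stronger_refl.
  + apply decision_And; [apply prv_hyp0|].
    unfold inst, p'; rewrite subst_comp; apply IH.
    eapply fbound_subst; [exact Hp|].
    intros [|i] Hi; simpl; lia.
Qed.

Lemma decided_Delta0 d n r :
  Delta0 d -> fbound n (subst r d) -> decided 0 n (subst r d).
Proof.
intros H; revert n r.
induction H as [|t u|t u|p q _ IHp _ IHq|p q _ IHp _ IHq|p q _ IHp _ IHq
  |t p _ IH|t p _ IH]; cbn [subst]; intros n r Hn.
- apply decided_false, P_ImpI, prv_hyp0.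
- destruct Hn; apply decided_Eq; auto.
- destruct Hn; apply decided_Le; auto.
- destruct Hn; apply decided_Imp; auto.
- destruct Hn; apply decided_And; auto.
- destruct Hn; apply decided_Or; auto.
- rewrite <- tshift_tsubst in *; destruct Hn as [[_ Ht] Hp]; apply decided_ball.
  + now apply tbound_tshift.
  + exact Hp.
  + intros m s; rewrite subst_comp; apply IH.
- rewrite <- tshift_tsubst in *; destruct Hn as [[_ Ht] Hp].
  apply decided_iff with (Neg (ball (tsubst r t) (Neg (subst (up r) p)))).
  + apply iff_sym, prv_bex.
  + apply decided_Neg, decided_ball.
    * now apply tbound_tshift.
    * split; [exact Hp|exact I].
    * intros m s [Hs _]; cbn [subst Neg]; apply decided_Neg.
      rewrite subst_comp in *; now apply IH.
Qed.

(** * Delta0-completeness, monotonicity and the derivability conditions *)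

Lemma inst_gdot0_quote G p : prv U G (Iff (inst Pr (gdot 0 p)) (inst Pr (quote p))).
Proof.
apply prv_eq_iff; unfold quote.
replace (gform p) with (teval (fun _ => 0) (gdot 0 p)).
- apply prv_nil, prv_eq_num_teval; [assumption|assumption|apply gdot_bound].
- rewrite gdot_spec, (subst_ext _ Var), subst_Var; [reflexivity|].
  intros i; unfold num_subst; simpl; f_equal; lia.
Qed.

Lemma Pr_top n s G :
  (forall p, T |-- p -> U |-- inst Pr (quote p)) ->
  prv U G (PrD s n (Neg Bot)).
Proof.
intros H.
assert (H1 : U |-- inst Pr (quote (Neg Bot))).
{ apply H, P_ImpI, prv_hyp0. }
pose proof (inst_gdot0_quote G (Neg Bot)) as H2.
(* No variable occurs in [Neg Bot], so its Goedel term is closed and the same for all [s] and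
   [n]. *)
change (PrD s n (Neg Bot)) with (inst Pr (gdot 0 (Neg Bot))).
ptaut (prv_nil G _ H1) H2.
Qed.

(** With the branches [Neg Bot] and [Bot], the conditional on [d] is equivalent to [d]; hence if [d]
    holds, its provability amounts to that of a theorem of [T]. *)
Lemma Delta0_complete d n :
  (forall p, T |-- p -> U |-- inst Pr (quote p)) ->
  Delta0 d -> fbound n d -> U |-- Imp d (inst Pr (gdot n d)).
Proof.
intros HD1 Hd Hn.
assert (H : decided 0 n d).
{ rewrite <- (subst_Var d) in Hn |- *; now apply decided_Delta0. }
pose proof (decided0E n d (Neg Bot) Bot nil Var H) as H1.
pose proof (Pr_top n Var nil HD1) as H2.
assert (H3 : U |-- Iff (PrD Var n d) (PrD Var n (ite d (Neg Bot) Bot))).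
{ apply PrD_iff; unfold ite; ptaut. }
rewrite <- PrD_Var; rewrite subst_Var in H1; unfold decides in H1; ptaut H1 H2 H3.
Qed.

(** The chain is Pr(p) <-> Pr(x(0)) -> exists v Pr(x(v)) -> Pr(exists v x(v)) <-> Pr(q), with CB_ex
    for one variable in the middle. *)
Lemma Pr_mono p q :
  cond_CBex U Pr -> T |-- Imp p q ->
  U |-- Imp (inst Pr (quote p)) (inst Pr (quote q)).
Proof.
(* At 0 this is the conjunction of q and p, hence p as p implies q; its existential closure is q,
   with 1 as a witness. *)
intros CB H; set (x := And (shift q) (Imp (Eq (Var 0) Zero) (shift p))).
assert (x_at : forall t, inst x t = And q (Imp (Eq t Zero) p)).
{ intros t; unfold x, inst; cbn [subst].
  fold (inst (shift p) t) (inst (shift q) t); now rewrite !inst_shift. }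
assert (H0 : U |-- Iff (PrD (scons Zero Var) 1 x) (PrD Var 0 p)).
{ rewrite (PrD_dotted _ Var 0 1 (scons Zero Var)); [|dotted_tac|pointwise].
  fold (inst x Zero); rewrite x_at; apply PrD_iff.
  ptaut H (P_EqI T nil Zero). }
assert (H1 : U |-- Iff (PrD Var 0 (Ex x)) (PrD Var 0 q)).
{ apply PrD_iff, P_AndI; apply P_ImpI.
  - eapply P_ExE; [apply prv_hyp0|]; eapply P_AndE1, prv_hyp0.
  - apply P_ExI with (Succ Zero); rewrite x_at.
    ptaut (prv_succ_neq0 HT TPA [q] Zero). }
rewrite PrD_Var in H0; rewrite !PrD_Var in H1.
pose proof (inst_gdot0_quote nil p) as Hp.
pose proof (inst_gdot0_quote nil q) as Hq.
pose proof (inst_gdot0_quote nil (Ex x)) as Hx.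
assert (H2 : U |-- Imp (PrD (scons Zero Var) 1 x)
(inst Pr (quote (Ex x)))).
{ apply P_ImpI; eapply P_ImpE; [apply prv_nil, (CB 1 x)|].
  apply P_ExI with Zero.
  rewrite <- PrD_Var; unfold inst; rewrite subst_PrD; apply prv_hyp0. }
assert (H3 : U |-- Iff (inst Pr (quote (Ex x))) (inst Pr (quote q)))
  by ptaut H1 Hq Hx.
ptaut H0 H2 H3 Hp.
Qed.

End Provability.

Theorem corollary3p18 (S T : form -> Prop)
  (S_ext : ce_extension_of_PA S) (S_con : consistent S)
  (T_ext : ce_extension_of_PA T) (T_con : consistent T)
  (TS : stronger T S)
  (Pr : form)
  (Pr_prov : provability_predicate S T Pr)
  (Pr_Sigma1 : Sigma1 Pr)
  (Pr_EU : cond_EU S T Pr)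
  (Pr_CBex : cond_CBex S Pr)
  (Pr_C : cond_C S Pr) :
  cond_D2 S Pr /\ cond_D3 S Pr.
Proof.
destruct S_ext as [HS [_ SPA]], T_ext as [HT [_ TPA]], Pr_prov as [HPr D1].
split; intros p.
- intros q.
  pose proof (Pr_C (Imp p q) p) as H1.
  assert (H2 : S |-- Imp (inst Pr (quote (And (Imp p q) p))) (inst Pr (quote q))).
  { apply (Pr_mono S T); try assumption; ptaut. }
  ptaut H1 H2.
- destruct Pr_Sigma1 as [n [d [Hd E]]].
  set (r := scons (quote p) Var).
  set (d' := subst (Nat.iter n up r) d).
  assert (E' : inst Pr (quote p) = exn n d').
  { rewrite E at 1; unfold inst; apply subst_exn. }
  assert (Hd' : Delta0 d') by now apply Delta0_subst.
  (* [quote p] is closed and [Pr] has at most one free variable, so only the [n] witnesses can be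
     free in the matrix, and all of them get dotted. *)
  assert (Hn : fbound n d').
  { replace n with (n + 0) by lia; apply fbound_exn; rewrite <- E'.
    eapply fbound_subst; [exact HPr|].
    intros [|i] Hi; [apply tbound_num|lia]. }
  (* CB_ex takes the existential quantifiers under the quotation; there remains completeness of the
     Delta0 matrix at each tuple of witnesses. *)
  rewrite E' at 1 2; apply P_ImpI; eapply P_ImpE; [apply prv_nil, Pr_CBex|].
  eapply P_ImpE; [|apply prv_hyp0]; apply prv_nil, exn_mono.
  apply (Delta0_complete S T); try assumption; apply D1.
Qed.
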